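(* Let $K=K(d)$ be a function of the integer $d\ge2$ with values in the positive integers, let $m_1=m_1(d)=\frac{\sqrt d}{\log^2(Kd)}$, and let $f$ be a random polynomial from $\mathcal P_{d,K}$ with independent and uniformly distributed coefficients. (1) If $K\le e^{d^{0.25}}/d$, then, in the limit as $d\to\infty$, the probability that $f$ is divisible by at least one polynomial with integer coefficients of positive degree not exceeding $m_1$ is at most $O\left(\sqrt{\frac Kd}\right)$. (2) If $c_2d\le K\le e^{(d^{0.25}/b)}/d$, where $b=\exp\left(e^{1/\sqrt[3]{4c_1}}/2\right)$ and $c_1,c_2$ are positive constants, then the probability that $f$ is divisible by at least one polynomial with integer coefficients of positive degree not exceeding $m_1$ is at most $O\left(\frac1K\right)$ as $d\to\infty$.
   Context: For $d,K\in\mathbb N$, $\mathcal P_{d,K}$ is the set of polynomials $f(x)=x^d+a_{d-1}x^{d-1}+\dots+a_1x+a_0$ with $a_0\neq 0$ and $a_i\in[-K,K]\cap\mathbb Z$ for all $0\le i\le d-1$. ''Independent and uniformly distributed coefficients'' means that $a_0,\dots,a_{d-1}$ are independent, each uniform on its set of allowed values (equivalently, $f$ is uniform on $\mathcal P_{d,K}$). Divisibility is in $\mathbb Z[x]$; $\log$ is the natural logarithm and $\log^2 y=(\log y)^2$. The implied constants may depend on $c_1,c_2$. *)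

(* Defs.v *)
From HB Require Import structures.
From mathcomp Require Import all_boot all_order all_algebra.
From mathcomp Require Import finmap.
From mathcomp Require Import all_classical all_reals all_analysis.

Set Implicit Arguments.
Unset Strict Implicit.
Unset Printing Implicit Defensive.

Import Order.TTheory GRing.Theory Num.Theory.
Import numFieldNormedType.Exports.

Local Open Scope classical_set_scope.
Local Open Scope ring_scope.

Definition coef_values (K i : nat) : set int :=
  [set k | `|k| <= K%:Z /\ (i = 0%N -> k != 0)].

Definition polyP (d K : nat) : set {poly int} :=
  [set f | [/\ f \is monic, size f = d.+1
             & forall i, (i < d)%N -> coef_values K i f`_i]].

(* Divisibility in Z[x]; the relation %| of polydiv on {poly int} is
   pseudo-divisibility, i.e. divisibility in Q[x]. *)
Definition divides_Zx (g f : {poly int}) : Prop :=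
  exists h : {poly int}, f = h * g.

Definition has_low_degree_divisor (R : realType) (m : R) (f : {poly int}) :
    Prop :=
  exists g : {poly int},
    [/\ (0 < (size g).-1)%N, (size g).-1%:R <= m & divides_Zx g f].

Section discrete_random_variables.
Context (disp : measure_display) (T : measurableType disp) (R : realType).
Variable P : probability T R.

(* int carries no canonical sigma-algebra; every set of integers is taken to
   be measurable. *)
Definition int_random_variable (X : T -> int) : Prop :=
  forall B : set int, measurable (X @^-1` B).

(* Meant for a finite nonempty set A: fset_set of an infinite set is empty. *)
Definition uniform_on (A : set int) (X : T -> int) : Prop :=
  forall k, A k -> P (X @^-1` [set k]) = ((#|` fset_set A|)%:R^-1)%:E.

Definition mutually_independent (I : finType) (X : I -> T -> int) : Prop :=
  forall (J : {set I}) (B : I -> set int),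
    P (\bigcap_(j in [set` J]) (X j @^-1` B j)) =
    (\prod_(j in J) P (X j @^-1` B j))%E.

Definition random_polyP (d K : nat) (f : T -> {poly int}) : Prop :=
  let a (i : 'I_d) (w : T) : int := (f w)`_i in
  [/\ forall w, polyP d K (f w),
      forall i, int_random_variable (a i),
      mutually_independent a
    & forall i : 'I_d, uniform_on (coef_values K i) (a i)].

End discrete_random_variables.

Definition m1 (R : realType) (d K : nat) : R :=
  Num.sqrt d%:R / ln (K%:R * d%:R) ^+ 2.

Definition b_const (R : realType) (c1 : R) : R :=
  expR (expR (1 / (4 * c1) `^ 3^-1) / 2).

(* Main.v *)
Require Import Defs.
From HB Require Import structures.
From mathcomp Require Import all_boot all_order all_algebra all_field all_fingroup.
From mathcomp Require Import finmap zify ring lra.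
From mathcomp Require Import all_classical all_reals all_analysis.

Set Implicit Arguments.
Unset Strict Implicit.
Unset Printing Implicit Defensive.
Import Order.TTheory GRing.Theory Num.Theory.
Import numFieldNormedType.Exports.

Local Open Scope ring_scope.

(** A divisor of f of degree at most m1 can be replaced by the minimal
    polynomial g of one of its roots, an algebraic integer. The theorem is a
    union bound over the possible g: there are few of them, and each divides f
    with small probability. Write n for the degree of g, Q = 2 K + 1, and M(g)
    for the Mahler measure, the product of max(1, |z|) over the roots z of g.

    Few polynomials. If g and h are distinct minimal polynomials of degree n
    and congruent modulo q, their resultant is a nonzero multiple of q ^ n.
    Hence the discriminant of the product of r such polynomials is at least
    q ^ (n r (r - 1)); on the other hand it is the square of a Vandermonde
    determinant of size r n, which the Leibniz formula bounds in terms of the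
    Mahler measures. If M(g) ^ 4 <= q for all of them, this forces r < 32 n, so
    that there are at most 32 n q ^ n minimal polynomials of degree n with
    M(g) ^ 4 <= q ([small_mahler_card]).

    Small probability. Fixing all coefficients of f but those at a set S of
    exponents, at most one choice of the latter makes f(z) vanish as soon as no
    nonzero difference supported on S vanishes at z, and the probability is
    then at most Q ^ (- |S|). With S = {0, ..., n - 1} this gives Q ^ (- n)
    ([vanishing_card_degree]). If |z| ^ E >= 2, the multiples of E t, where
    2 ^ (t - 1) < Q <= 2 ^ t, give 2 ^ (- d / (2 E))
    ([vanishing_card_large]); since the largest root of g has modulus at least
    M(g) ^ (1 / n), this is useful whenever M(g) is not close to 1.

    Large measures. Landau's inequality gives M(g) ^ 2 <= 2 d K ^ 2
    ([mahler_factor_le]), so at most 32 n (4 d ^ 2 K ^ 4) ^ n polynomials have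
    M(g) ^ 4 > 2, each with probability at most 2 ^ (- d / (8 n)). The value of
    m1 is such that these products add up to at most 1 / (K d)
    ([sum_large_mahler_le]).

    Small measures. At most 32 n 2 ^ n polynomials have M(g) ^ 4 <= 2, and each
    divides f with probability at most Q ^ (- n). As 2 / Q <= min(2 / 3, 1 / K),
    the sum over n is O(1 / K), which proves part (2).

    For part (1) the bound O(d ^ (- 1 / 2)), which is O((K / d) ^ (1 / 2)), is
    needed even if K is bounded. The previous sum restricted to n >= N, where 2 ^ N is about d ^ 0.9, is small
    enough, since (2 / 3) ^ N is smaller than d ^ (- 1 / 2). For n < N a
    quantitative form of Kronecker's theorem ([kronecker_effective]) shows that
    either M(g) ^ (2 ^ (n + 3)) > 2, and then the bound for large roots is
    superpolynomially small, or the roots of g are roots of unity, of some order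
    k <= 2 n ^ 2. In this last case the coefficients at the multiples of k enter
    f(z) through their sum only, and a sum of D independent uniform digits takes
    any given value with probability O(D ^ (- 1 / 2))
    ([coef_interval_power_le]); together with the exponents 1, ..., n - 1 this
    gives O(n d ^ (- 1 / 2) Q ^ (1 - n)) ([vanishing_card_unity]), whose sum
    over k and n is O(d ^ (- 1 / 2)).

    Probabilities are compared with densities of sets of digit sequences:
    letting the constant coefficient take the value 0 as well makes all
    coefficients identically distributed, at the cost of a factor
    Q / (2 K) <= 3 / 2 ([probability_low_degree_le]). *)

(** * Minimal polynomials of algebraic integers *)

Notation pC := (map_poly (intr : int -> algC)).

Definition croots (p : {poly algC}) : seq algC :=
  sval (closed_field_poly_normal p).

Definition zroots (g : {poly int}) : seq algC := croots (pC g).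

Lemma croots_factor (p : {poly algC}) : p \is monic ->
  p = \prod_(z <- croots p) ('X - z%:P).
Proof.
move=> /monicP lp; rewrite /croots; case: closed_field_poly_normal => r /= {1}->.
by rewrite lp scale1r.
Qed.

Lemma zroots_factor (g : {poly int}) : g \is monic ->
  pC g = \prod_(z <- zroots g) ('X - z%:P).
Proof. by move=> mg; apply/croots_factor/monic_map. Qed.

Lemma size_pC (g : {poly int}) : size (pC g) = size g.
Proof. by apply: size_map_inj_poly => //; exact: intr_inj. Qed.

Lemma pC_inj : injective (fun g : {poly int} => pC g).
Proof. by apply: map_inj_poly => //; exact: intr_inj. Qed.

Lemma size_zroots (g : {poly int}) : g \is monic -> size (zroots g) = (size g).-1.
Proof.
move=> mg; rewrite -(size_pC g) (zroots_factor mg) size_prod_XsubC //.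
Qed.

Lemma root_zroots (g : {poly int}) z : g \is monic ->
  root (pC g) z = (z \in zroots g).
Proof. by move=> mg; rewrite (zroots_factor mg) root_prod_XsubC. Qed.

Lemma map_ratr_intr (h : {poly int}) :
  map_poly (ratr : rat -> algC) (map_poly intr h) = pC h.
Proof. by rewrite -map_poly_comp; apply: eq_map_poly => b; rewrite /= rmorph_int. Qed.

(** Divisibility is in Z[x], not in Q[x]; the last condition implies that [g] is
    irreducible. *)
Definition int_minpoly (g : {poly int}) : Prop :=
  [/\ g \is monic, (1 < size g)%N &
    forall (u : {poly int}) (z : algC), root (pC g) z -> root (pC u) z ->
      exists h, u = h * g].

(** Over the algebraic numbers an integral element has a minimal polynomial with
    integer coefficients. Division by a monic polynomial stays in Z[x], and the
    remainder vanishes because its degree is too small. *)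
Lemma int_minpoly_exists (f : {poly int}) (z : algC) :
  f \is monic -> root (pC f) z -> exists2 g, int_minpoly g & root (pC g) z.
Proof.
move=> mf fz.
have Az : z \in Aint.
  apply: (root_monic_Aint fz); first exact: monic_map.
  by apply/polyOverP => i; rewrite coef_map /=; apply: intr_int.
have [g Dg] : exists g : {poly int}, minCpoly z = pC g.
  by move: Az; rewrite unfold_in => /floorpP[g Dg]; exists g.
have lead_pC (h : {poly int}) : lead_coef (pC h) = (lead_coef h)%:~R.
  by rewrite lead_coef_map_inj //; exact: intr_inj.
have mg : g \is monic.
  have := minCpoly_monic z; rewrite Dg !monicE lead_pC -[1]/(1%:~R).
  by rewrite eqr_int.
exists g; last by rewrite -Dg root_minCpoly.
split=> //; first by rewrite -(size_pC g) -Dg size_minCpoly.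
move=> u y gy uy.
have [p [Dp mp dvp]] := minCpolyP z.
have [q [Dq mq dvq]] := minCpolyP y.
have QC := map_ratr_intr.
(* y has the same minimal polynomial as z *)
have Epq : p = q.
  have qp : q %| p by rewrite -dvq -Dp Dg.
  apply/eqP; rewrite -eqp_monic //; apply/andP; split=> //.
  have /dvdpP[r Dr] := qp.
  have : root (map_poly ratr p) z by rewrite dvp.
  rewrite {1}Dr rmorphM rootM => /orP[|]; rewrite dvp //.
  move=> /dvdp_leq; have r0 : r != 0.
    by apply: contraTneq (monic_neq0 mp) => r0; rewrite Dr r0 mul0r eqxx.
  move=> /(_ r0); rewrite Dr size_mul ?(monic_neq0 mq) //.
  have := size_minCpoly y; rewrite Dq size_map_poly => sq le.
  have := size_poly_gt0 r; rewrite r0; move: le sq.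
  set a := size r; set b := size q; lia.
have Eu := Pdiv.RingMonic.rdivp_eq mg u.
suff R0 : Pdiv.Ring.rmodp u g = 0.
  by exists (Pdiv.Ring.rdivp u g); rewrite R0 addr0 in Eu.
apply: pC_inj; rewrite rmorph0; apply/eqP/negPn/negP => r0.
have : root (pC (Pdiv.Ring.rmodp u g)) y.
  have -> : Pdiv.Ring.rmodp u g = u - Pdiv.Ring.rdivp u g * g.
    by apply/eqP; rewrite eq_sym subr_eq addrC -Eu.
  by rewrite rmorphB rmorphM /= /root !hornerE (rootP uy) (rootP gy) mulr0 subr0.
rewrite -QC dvq -Epq => /dvdp_leq.
rewrite -(map_poly_eq0 (ratr : rat -> algC)) QC => /(_ r0).
rewrite -(size_map_poly (ratr : rat -> algC)) -Dp Dg.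
rewrite -(size_map_poly (ratr : rat -> algC) (map_poly _ _)) QC !size_pC leqNgt.
by rewrite Pdiv.Ring.ltn_rmodp (monic_neq0 mg).
Qed.

(** * Integral norms and the Mahler measure *)

Lemma prodr_const_seq (R : pzSemiRingType) (T : Type) (s : seq T) (x : R) :
  \prod_(i <- s) x = x ^+ size s.
Proof. by rewrite big_const_seq count_predT iter_mulr_1. Qed.

(** The eigenvalues of [horner_mx A h] are the values of [h] at those of [A];
    factoring [h] reduces this to the definition of the characteristic
    polynomial, without triangularising [A]. *)
Lemma det_horner_mx (n : nat) (A : 'M[algC]_n.+1) (s : seq algC) (h : {poly algC}) :
  char_poly A = \prod_(z <- s) ('X - z%:P) ->
  \det (horner_mx A h) = \prod_(z <- s) h.[z].
Proof.
move=> cA.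
have szs : size s = n.+1.
  by apply/eqP; rewrite -eqSS -(size_prod_XsubC s id) -cA size_char_poly.
have linear_case y : \det (horner_mx A ('X - y%:P)) = \prod_(z <- s) (z - y).
  rewrite rmorphB /= horner_mx_X horner_mx_C.
  have -> : A - y%:M = - map_mx (horner_eval y) (char_poly_mx A).
    apply/matrixP => i j; rewrite !mxE /horner_eval !hornerE.
    by case: (i == j); rewrite ?mulr1n ?mulr0n ?hornerE; ring.
  rewrite -scaleN1r detZ -[\det (map_mx _ _)]/(\det (map_mx (horner_eval y) _)).
  rewrite det_map_mx -/(char_poly A) cA /= horner_evalE horner_prod -szs.
  rewrite -prodr_const_seq -big_split.
  by apply: eq_bigr => z _ /=; rewrite !hornerE; ring.
have [r ->] := closed_field_poly_normal h.
rewrite linearZ /= detZ rmorph_prod /=.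
under [RHS]eq_bigr do rewrite hornerZ.
rewrite big_split /= prodr_const_seq szs; congr (_ * _).
elim: r => [|y r IH].
  by rewrite !big_nil det1 big1 // => z _; rewrite hornerC.
rewrite big_cons det_mulmx IH linear_case -big_split; apply: eq_bigr => z _ /=.
by rewrite big_cons hornerM !hornerE.
Qed.

(** This is the norm of [h] in the ring Z[x]/(g), that is the determinant of
    [h] evaluated at an integral companion matrix of [g]. *)
Lemma prod_zroots_int (g h : {poly int}) : g \is monic ->
  \prod_(z <- zroots g) (pC h).[z] \in Num.int.
Proof.
move=> mg; have [sz1|] := leqP (size g) 1.
  have : size (zroots g) = 0%N by rewrite size_zroots //; case: (size g) sz1 => [|[]].
  by case: (zroots g) => // _; rewrite big_nil int_num1.
case Dn : (size g) => [|[|n]] // _.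
have [A cA] : exists A : 'M[int]_n.+1, char_poly A = g.
  have := companionmxK mg; move: (companionmx g); rewrite Dn /= => A cA.
  by exists A.
rewrite -(@det_horner_mx _ (map_mx intr A)); last first.
  by rewrite -map_char_poly cA -zroots_factor.
by rewrite -map_horner_mx det_map_mx intr_int.
Qed.

(** The norm of [q] is [q ^ n], and a nonzero integer has absolute value at
    least one. *)
Lemma norm_prod_zroots_ge (g u : {poly int}) (q : nat) : g \is monic ->
  \prod_(z <- zroots g) (pC (q%:Z *: u)).[z] != 0 ->
  (q ^ (size g).-1)%:R <= `|\prod_(z <- zroots g) (pC (q%:Z *: u)).[z]|.
Proof.
move=> mg.
have -> : \prod_(z <- zroots g) (pC (q%:Z *: u)).[z] =
    q%:R ^+ (size g).-1 * \prod_(z <- zroots g) (pC u).[z].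
  rewrite -size_zroots // -prodr_const_seq -big_split; apply: eq_bigr => z _ /=.
  by rewrite map_polyZ /= hornerZ.
rewrite mulf_eq0 negb_or => /andP[_ nz].
rewrite normrM normrX normr_nat natrX ler_peMr ?exprn_ge0 //.
by rewrite norm_intr_ge1 // prod_zroots_int.
Qed.

Definition max1 (z : algC) : algC := Num.max 1 `|z|.

Lemma max1_ge1 z : 1 <= max1 z.
Proof. by rewrite comparable_le_max ?lexx ?real_comparable ?realE ?ler01 ?normr_ge0. Qed.

Lemma max1_ge0 z : 0 <= max1 z. Proof. exact: le_trans (max1_ge1 z). Qed.

Lemma max1_norm z : `|z| <= max1 z.
Proof.
by rewrite comparable_le_max ?lexx ?orbT ?real_comparable ?realE ?ler01 ?normr_ge0.
Qed.

Lemma max1X z n : max1 (z ^+ n) = max1 z ^+ n.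
Proof.
have cmp (x : algC) : 1 >=< `|x| by rewrite real_comparable ?realE ?ler01 ?normr_ge0.
rewrite /max1 normrX; have [z1|z1] := comparable_leP (cmp z).
  by rewrite max_r // exprn_ege1.
by rewrite expr1n max_l // exprn_ile1 // ltW.
Qed.

Definition mahler (g : {poly int}) : algC := \prod_(z <- zroots g) max1 z.

Lemma mahler_ge1 g : 1 <= mahler g.
Proof.
rewrite /mahler; elim: (zroots g) => [|z s IH]; first by rewrite big_nil.
by rewrite big_cons mulr_ege1 // max1_ge1.
Qed.

(** The left-hand side is the absolute value of the discriminant of the family,
    that is the square of a Vandermonde determinant, whose Leibniz expansion
    is bounded termwise. *)
Lemma vandermonde_bound (I : finType) (c : I -> algC) :
  \prod_x \prod_(y | y != x) `|c x - c y|
    <= ((#|I|)`!)%:R ^+ 2 * (\prod_x max1 (c x)) ^+ (#|I|.-1).*2.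
Proof.
set N := #|I|.
pose a := \row_(i < N) c (enum_val i).
have -> : \prod_x \prod_(y | y != x) `|c x - c y| = `|\det (Vandermonde N a)| ^+ 2.
  rewrite det_Vandermonde.
  rewrite (reindex _ (onW_bij _ (enum_val_bij I))) /= -/N.
  have -> : \prod_(j < N) \prod_(y | y != enum_val j) `|c (enum_val j) - c y| =
     (\prod_(j < N) \prod_(i < N | (j < i)%N) `|a 0 i - a 0 j|) *
     (\prod_(j < N) \prod_(i < N | (i < j)%N) `|a 0 i - a 0 j|).
    rewrite -big_split; apply: eq_bigr => j _ /=.
    rewrite (reindex _ (onW_bij _ (enum_val_bij I))) /=.
    rewrite (bigID (fun i : 'I_N => (j < i)%N)) /=.
    have neqE (i : 'I_N) : (enum_val i != enum_val j) = (i != j :> nat).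
      by rewrite (inj_eq enum_val_inj).
    congr *%R; apply: eq_big => i; rewrite ?neqE.
    - by rewrite andbC; case: (ltngtP i j).
    - by move=> _; rewrite !mxE distrC.
    - by rewrite -leqNgt andbC; case: (ltngtP i j).
    - by move=> _; rewrite !mxE distrC.
  have -> : \prod_(j < N) \prod_(i < N | (i < j)%N) `|a 0 i - a 0 j| =
            \prod_(j < N) \prod_(i < N | (j < i)%N) `|a 0 i - a 0 j|.
    rewrite (exchange_big_dep xpredT) //=; apply: eq_bigr => j _.
    by apply: eq_bigr => i _; rewrite distrC.
  rewrite -expr2 normr_prod; congr (_ ^+ 2).
  by apply: eq_bigr => j _; rewrite normr_prod.
have H0 : 0 <= (N`!)%:R * (\prod_x max1 (c x)) ^+ N.-1.
  by rewrite mulr_ge0 ?exprn_ge0 ?prodr_ge0 // => x _; apply: max1_ge0.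
rewrite -muln2 exprM -exprMn lerXn2r ?nnegrE //.
apply: le_trans (ler_norm_sum _ _ _) _.
rewrite -card_Sn -sum1_card natr_sum mulr_suml; apply: ler_sum => s _.
rewrite mul1r normrM normrX normrN normr1 expr1n mul1r normr_prod.
rewrite (reindex _ (onW_bij _ (enum_val_bij I))) /= -prodrXl.
rewrite [leRHS](reindex_inj (@perm_inj _ s)) /=.
apply: ler_prod => i _; rewrite !mxE normr_ge0 normrX /=.
apply: le_trans (_ : max1 (c (enum_val (s i))) ^+ i <= _).
  by rewrite lerXn2r ?nnegrE ?max1_norm ?max1_ge0.
by rewrite ler_weXn2l ?max1_ge1 //; have := ltn_ord i; lia.
Qed.

(** * Minimal polynomials congruent modulo an integer *)

Lemma int_minpoly_size_le (g u : {poly int}) z : int_minpoly g ->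
  root (pC g) z -> root (pC u) z -> u != 0 -> (size g <= size u)%N.
Proof.
case=> mg _ dvg gz uz u0; have [h Du] := dvg u z gz uz.
have h0 : h != 0 by apply: contraNneq u0 => h0; rewrite Du h0 mul0r.
have := size_poly_gt0 h; rewrite h0 Du size_mul ?(monic_neq0 mg) //.
by set a := size h; set b := size g; lia.
Qed.

Lemma int_minpoly_eq (g h : {poly int}) z : int_minpoly g -> int_minpoly h ->
  root (pC g) z -> root (pC h) z -> g = h.
Proof.
move=> Mg Mh gz hz; have [mg _ dvg] := Mg; have [mh _ dvh] := Mh.
have [k Dh] := dvg h z gz hz.
have k0 : k != 0.
  by apply: contraTneq (monic_neq0 mh) => k0; rewrite Dh k0 mul0r eqxx.
have szk : size k = 1%N.
  have := int_minpoly_size_le Mh hz gz (monic_neq0 mg).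
  have := size_poly_gt0 k; rewrite k0 Dh size_mul ?(monic_neq0 mg) //.
  have := size_poly_gt0 g; rewrite (monic_neq0 mg).
  by set a := size k; set b := size g; lia.
have : lead_coef h = 1 by apply/monicP.
rewrite Dh lead_coefM (monicP mg) mulr1 [in k * g](size1_polyC (eq_leq szk)).
by rewrite lead_coefE szk /= => ->; rewrite mul1r.
Qed.

(** The derivative has a smaller degree, so it cannot vanish at a root: the
    roots are simple. *)
Lemma int_minpoly_deriv (g : {poly int}) z : int_minpoly g -> root (pC g) z ->
  (pC g^`()).[z] != 0.
Proof.
move=> Mg gz; have [mg sg _] := Mg; apply/negP => dz.
have szd : (size g^`() < size g)%N by rewrite lt_size_deriv // monic_neq0.
have := int_minpoly_size_le Mg gz dz; rewrite leqNgt szd.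
suff d0 : g^`() != 0 by move=> /(_ d0).
apply/eqP => /polyP /(_ (size g).-2); rewrite coef_deriv coef0.
have -> : ((size g).-2.+1 = (size g).-1)%N by move: sg; case: (size g) => [|[]].
rewrite -/(lead_coef g) (monicP mg) => /eqP; rewrite pnatr_eq0.
by move: sg; case: (size g) => [|[]].
Qed.

Lemma deriv_prod_XsubC_root (F : fieldType) (n : nat) (c : 'I_n -> F) (a : 'I_n) :
  (\prod_b ('X - (c b)%:P))^`().[c a] = \prod_(b | b != a) (c a - c b).
Proof.
rewrite (bigD1 a) //= derivM derivXsubC mul1r hornerD !hornerM !hornerE subrr.
rewrite mul0r addr0 horner_prod; apply: eq_bigr => b _.
by rewrite !hornerE.
Qed.

Section CongruentFamily.

Variables (n q r : nat) (g : 'I_r -> {poly int}).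
Hypothesis q_gt0 : (0 < q)%N.
Hypothesis g_inj : injective g.
Hypothesis g_min : forall i, int_minpoly (g i).
Hypothesis g_size : forall i, size (g i) = n.+1.
Hypothesis g_congr : forall i j, exists u, g j - g i = q%:Z *: u.

Let c (x : 'I_r * 'I_n) : algC := nth 0 (zroots (g x.1)) x.2.

Let g_monic i : g i \is monic. Proof. by case: (g_min i). Qed.

Let sz_zr i : size (zroots (g i)) = n. Proof. by rewrite size_zroots ?g_size. Qed.

Let big_zroots (i : 'I_r) (R : Type) (idx : R) (op : Monoid.com_law idx) (F : algC -> R) :
  \big[op/idx]_(z <- zroots (g i)) F z = \big[op/idx]_(a < n) F (c (i, a)).
Proof. by rewrite (big_nth 0) sz_zr big_mkord. Qed.

Let root_c i a : root (pC (g i)) (c (i, a)).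
Proof. by rewrite root_zroots // mem_nth // sz_zr. Qed.

(** Distinct members have a common root modulo [q], [n] times over, so their
    resultant is a nonzero multiple of [q ^ n]; each discriminant is a nonzero
    integer. *)
Lemma prod_root_differences_ge :
  (q ^ (n * (r * r.-1)))%:R <= \prod_x \prod_(y | y != x) `|c x - c y|.
Proof.
have inner i a : \prod_(y | y != (i, a)) `|c (i, a) - c y| =
    `|(pC (g i)^`()).[c (i, a)]| *
    \prod_(j | j != i) `|(pC (g j)).[c (i, a)]|.
  rewrite (eq_bigl (fun y => predT y.1 && ((y.1 == i) ==> (y.2 != a)))); last first.
    by move=> [j b]; rewrite xpair_eqE negb_and implybE.
  rewrite (eq_bigr (fun y => `|c (i, a) - c (y.1, y.2)|)); last by case.
  rewrite -(pair_big_dep predT (fun j b => (j == i) ==> (b != a))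
             (fun j b => `|c (i, a) - c (j, b)|)) /=.
  rewrite (bigD1 i) //= eqxx /=; congr (_ * _).
    rewrite -deriv_map zroots_factor // big_zroots.
    by rewrite deriv_prod_XsubC_root normr_prod.
  apply: eq_bigr => j ji; rewrite (negPf ji) /=.
  rewrite zroots_factor // big_zroots horner_prod normr_prod.
  by apply: eq_bigr => b _; rewrite !hornerE.
rewrite -(pair_bigA _ (fun i a => \prod_(y | y != (i, a)) `|c (i, a) - c y|)) /=.
have rowi i : (q ^ (n * r.-1))%:R <=
    \prod_(a < n) \prod_(y | y != (i, a)) `|c (i, a) - c y|.
  under eq_bigr do rewrite inner.
  rewrite big_split exchange_big /= -[leLHS]mul1r; apply: ler_pM => //.
    rewrite -normr_prod -(big_zroots _ _ (fun z => (pC (g i)^`()).[z])).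
    rewrite norm_intr_ge1 ?prod_zroots_int //.
    rewrite big_zroots; apply/prodf_neq0 => a _.
    exact: int_minpoly_deriv (g_min i) (root_c i a).
  have -> : (q ^ (n * r.-1))%:R = \prod_(j < r | j != i) ((q ^ n)%:R : algC).
    by rewrite prodr_const expnM natrX cardC1 card_ord.
  apply: ler_prod => j ji; rewrite ler0n -normr_prod.
  rewrite -(big_zroots _ _ (fun z => (pC (g j)).[z])) /=.
  have [u Du] := g_congr i j.
  have -> : \prod_(z <- zroots (g i)) (pC (g j)).[z] =
            \prod_(z <- zroots (g i)) (pC (q%:Z *: u)).[z].
    apply: eq_big_seq => z; rewrite -root_zroots // => /rootP gz.
    by rewrite -Du rmorphB /= hornerD hornerN gz subr0.
  have := @norm_prod_zroots_ge (g i) u q (g_monic i); rewrite g_size /=; apply.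
  rewrite prodf_seq_neq0; apply/allP => z; rewrite -root_zroots // => gz /=.
  rewrite -Du rmorphB /= hornerD hornerN (rootP gz) subr0.
  apply: contraNneq ji => gjz; apply/eqP/g_inj/(@int_minpoly_eq _ _ z) => //.
  exact/rootP.
rewrite mulnCA mulnC expnM natrX -[r in _ ^+ r]card_ord -prodr_const.
by apply: ler_prod => i _; rewrite ler0n rowi.
Qed.

Hypothesis g_mahler : forall i, mahler (g i) ^+ 4 <= q%:R.

(** The discriminant is at least q ^ (n r (r - 1)), and the Mahler measures
    contribute at most q ^ (n r ^ 2 / 2) to its upper bound, so that
    q ^ (n r (r - 2) / 2) is at most the square of the factorial of r n. *)
Lemma congruent_family_card : (0 < n)%N -> (1 < r)%N ->
  (q ^ (r - 2) <= (r * n) ^ 4)%N.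
Proof.
move=> n_gt0 r_gt1; set N := (r * n)%N.
have cI : #|{: 'I_r * 'I_n}| = N by rewrite card_prod !card_ord.
have := le_trans prod_root_differences_ge (vandermonde_bound c); rewrite cI.
have -> : \prod_x max1 (c x) = \prod_i mahler (g i).
  rewrite -(pair_bigA _ (fun i a => max1 (c (i, a)))) /=.
  by apply: eq_bigr => i _; rewrite /mahler big_zroots.
set P := \prod_i _ => le1.
have P0 : 0 <= P by apply: prodr_ge0 => i _; apply: le_trans (mahler_ge1 _).
have P4 : P ^+ 4 <= q%:R ^+ r.
  rewrite -prodrXl -[r in _ ^+ r]card_ord -prodr_const; apply: ler_prod => i _.
  by rewrite exprn_ge0 ?g_mahler //; apply: le_trans (mahler_ge1 _); rewrite ler01.
have : ((q ^ (n * (r * r.-1))) ^ 2)%:R <= ((N ^ N) ^ 4 * (q ^ r) ^ N)%:R :> algC.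
  rewrite natrX natrM.
  apply: le_trans (_ : ((N`!)%:R ^+ 2 * P ^+ N.-1.*2) ^+ 2 <= _).
    by rewrite lerXn2r ?nnegrE // mulr_ge0 ?exprn_ge0.
  rewrite exprMn -!exprM; apply: ler_pM; rewrite ?exprn_ge0 //.
    rewrite [leRHS]natrX lerXn2r ?nnegrE // ler_nat.
    rewrite -ffactnn ffact_prod -[X in (_ ^ X)%N]card_ord -prod_nat_const.
    by apply: leq_prod => i _; apply: leq_subr.
  have -> : ((N.-1).*2 * 2 = 4 * N.-1)%N by lia.
  rewrite exprM (natrX _ (q ^ r)) natrX.
  apply: le_trans (_ : (q%:R ^+ r) ^+ N.-1 <= _).
    by rewrite lerXn2r ?nnegrE ?exprn_ge0.
  rewrite ler_weXn2l //; last by lia.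
  by rewrite -natrX ler1n expn_gt0 q_gt0.
rewrite ler_nat -!expnM.
have -> : (n * (r * r.-1) * 2 = N * (r - 2) + r * N)%N.
  by rewrite /N; case: r r_gt1 => [|[|k]] // _; nia.
rewrite expnD leq_pmul2r ?expn_gt0 ?q_gt0 // !(mulnC N) !expnM.
by rewrite !leq_exp2r // ltnW.
Qed.

End CongruentFamily.

Lemma pow4_lt_exp2 n : (0 < n)%N -> ((32 * n * n) ^ 4 < 2 ^ (32 * n - 2))%N.
Proof.
move=> n_gt0; have lt2 : (n ^ 8 < 2 ^ (8 * n))%N.
  by rewrite mulnC expnM ltn_exp2r // ltn_expl.
have -> : ((32 * n * n) ^ 4 = 2 ^ 20 * n ^ 8)%N.
  by rewrite !expnMn -mulnA -expnD -[32%N]/(2 ^ 5)%N -expnM.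
have -> : (32 * n - 2 = 20 + (8 * n + (24 * n - 22)))%N by lia.
rewrite expnD ltn_pmul2l ?expn_gt0 // expnD (leq_trans lt2) //.
by rewrite leq_pmulr // expn_gt0.
Qed.

Definition residues (n q : nat) (g : {poly int}) : {ffun 'I_n -> 'I_q.+1} :=
  [ffun i : 'I_n => inord `|(g`_i %% q.+1%:Z)%Z|%N].

Lemma residues_congr (n q : nat) (g h : {poly int}) : g \is monic -> h \is monic ->
  size g = n.+1 -> size h = n.+1 -> residues n q g = residues n q h ->
  exists u, h - g = q.+1%:Z *: u.
Proof.
move=> mg mh sg sh E.
exists (\poly_(i < n) ((h - g)`_i %/ q.+1%:Z)%Z).
apply/polyP => i; rewrite coefZ coef_poly; case: ltnP => [lt_in|le_ni].
  have /ffunP/(_ (Ordinal lt_in)) := E; rewrite !ffunE => /(congr1 val).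
  have mod_lt (p : {poly int}) : (`|(p`_i %% q.+1%:Z)%Z|%N < q.+1)%N.
    by rewrite -ltz_nat gez0_abs ?modz_ge0 ?ltz_pmod.
  rewrite /= !inordK //.
  move=> /(congr1 Posz); rewrite !gez0_abs ?modz_ge0 // => Emod.
  rewrite mulrC divzK //; rewrite coefB.
  by rewrite -eqz_mod_dvd; apply/eqP; rewrite Emod.
rewrite mulr0 coefB; apply/eqP; rewrite subr_eq0; apply/eqP.
move: le_ni; rewrite leq_eqVlt => /predU1P[<-|lt_ni].
  have -> : n = (size g).-1 by rewrite sg.
  rewrite -lead_coefE (monicP mg) sg.
  by rewrite -[n in LHS]/(n.+1.-1) -sh -lead_coefE (monicP mh).
by rewrite !nth_default ?sg ?sh.
Qed.

(** Fewer than [32 * n] of these polynomials fall into each of the [q ^ n]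
    residue classes modulo [q]. *)
Lemma small_mahler_card (n q : nat) (s : seq {poly int}) : (0 < n)%N -> (1 < q)%N ->
  uniq s ->
  (forall g, g \in s -> [/\ int_minpoly g, size g = n.+1 & mahler g ^+ 4 <= q%:R]) ->
  (size s <= 32 * n * q ^ n)%N.
Proof.
case: q => // q n_gt0 q_gt1 us Hs.
have class_le c : (count (fun g => residues n q g == c) s <= 32 * n)%N.
  rewrite leqNgt; apply/negP => lt; set t := [seq g <- s | residues n q g == c].
  have st : size t = count (fun g => residues n q g == c) s by rewrite size_filter.
  pose r := (32 * n)%N; pose g (i : 'I_r) := nth 0 t i.
  have lt_it (i : 'I_r) : (i < size t)%N by rewrite st (ltn_trans _ lt).
  have gt i : (g i \in s) /\ (residues n q (g i) = c).
    by have := mem_nth 0 (lt_it i); rewrite mem_filter => /andP[/eqP-> ->].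
  have g_inj : injective g.
    move=> i j /eqP; rewrite nth_uniq ?filter_uniq //.
    by move=> /eqP ij; apply: val_inj.
  have := @congruent_family_card n q.+1 r g isT g_inj.
  have H i := Hs _ (gt i).1.
  have H1 i : int_minpoly (g i) by case: (H i).
  have H2 i : size (g i) = n.+1 by case: (H i).
  have H3 i : mahler (g i) ^+ 4 <= q.+1%:R by case: (H i).
  have mon i : g i \is monic by case: (H1 i).
  have H4 i j : exists u, g j - g i = q.+1%:Z *: u.
    by apply: (@residues_congr n); rewrite ?mon ?H2 // !(gt _).2.
  move=> /(_ H1 H2 H4 H3 n_gt0); rewrite (_ : (1 < r)%N); last by rewrite /r; lia.
  move=> /(_ isT); rewrite leqNgt (leq_trans (pow4_lt_exp2 n_gt0)) //.
  by rewrite leq_exp2r // /r; lia.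
rewrite -(card_ord q.+1) -[X in (_ ^ X)%N](card_ord n) -card_ffun -sum1_size.
rewrite (partition_big (residues n q) predT) //=.
rewrite mulnC -sum_nat_const; apply: leq_sum => c _.
by rewrite sum1_count.
Qed.

(** * Landau's inequality *)

(** On the unit circle X - z and its reciprocal have the same modulus, so this
    is Parseval's identity; coefficientwise the difference telescopes. *)
Lemma sumsq_reciprocal_factor (p : {poly algC}) (z : algC) (n : nat) :
  (size p < n)%N ->
  \sum_(i < n) `|(p * ('X - z%:P))`_i| ^+ 2 =
  \sum_(i < n) `|(p * (z^* *: 'X - 1))`_i| ^+ 2.
Proof.
move=> lt_pn; apply/eqP; rewrite -subr_eq0 -sumrB; apply/eqP.
pose a i : algC := if i is j.+1 then p`_j else 0.
have E i : `|(p * ('X - z%:P))`_i| ^+ 2 - `|(p * (z^* *: 'X - 1))`_i| ^+ 2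
   = (`|z| ^+ 2 - 1) * (`|a i.+1| ^+ 2 - `|a i| ^+ 2).
  have -> : (p * ('X - z%:P))`_i = a i - z * a i.+1.
    by rewrite mulrBr coefB coefMX coefMC mulrC /a; case: i.
  have -> : (p * (z^* *: 'X - 1))`_i = z^* * a i - a i.+1.
    by rewrite mulrBr -scalerAr coefB coefZ coefMX mulr1 /a; case: i.
  rewrite !normCK !rmorphB !rmorphM /= conjCK.
  by move: (a i) (a i.+1) => u v; ring.
under eq_bigr do rewrite E.
rewrite -mulr_sumr -(big_mkord xpredT (fun i => `|a i.+1| ^+ 2 - `|a i| ^+ 2)).
rewrite telescope_sumr //; case: n lt_pn => // n; rewrite ltnS => le.
by rewrite /= nth_default // normr0 expr0n subrr mulr0.
Qed.

(** Each root outside the unit disc is traded for its reciprocal, which multiplies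
    the leading coefficient by the modulus of the root; a leading coefficient
    never exceeds the 2-norm. *)
Lemma sumsq_ge_lead_mahler (s : seq algC) (p : {poly algC}) (n : nat) :
  p != 0 -> (size p + size s <= n)%N ->
  `|lead_coef p| ^+ 2 * (\prod_(z <- s) max1 z) ^+ 2
    <= \sum_(i < n) `|(p * \prod_(z <- s) ('X - z%:P))`_i| ^+ 2.
Proof.
elim: s p => [|z s IH] p p0 le_n.
  rewrite !big_nil mulr1 expr1n mulr1.
  have lt : ((size p).-1 < n)%N.
    by rewrite prednK ?size_poly_gt0 //; rewrite /= addn0 in le_n.
  by rewrite (bigD1 (Ordinal lt)) //= lead_coefE lerDl sumr_ge0 // => i _; rewrite exprn_ge0.
rewrite !big_cons [p * _]mulrA.
have zX : z%:P = z *: 1 by rewrite -[in LHS](mulr1 z) -mul_polyC polyCM mulr1.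
have szX : size ('X - z%:P) = 2%N by rewrite size_XsubC.
have cmp : 1 >=< `|z| by rewrite real_comparable ?realE ?ler01 ?normr_ge0.
have [z1|z1] := comparable_leP cmp; last first.
  have -> : max1 z = 1 by apply/max_l/ltW.
  rewrite mul1r.
  have := IH (p * ('X - z%:P)); rewrite lead_coefM lead_coefXsubC mulr1; apply.
    by rewrite mulf_neq0 ?polyXsubC_eq0.
  by rewrite size_mul ?polyXsubC_eq0 // szX addn2 /= addSn -addnS.
have z0 : z^* != 0.
  by rewrite conjC_eq0; apply: contraTneq z1 => ->; rewrite normr0 ler10.
have nz : z^* *: 'X - 1 != 0 :> {poly algC}.
  by apply/eqP => /polyP /(_ 1%N) /eqP; rewrite !coefE subr0 mulr1 (negPf z0).
have sz2 : size (z^* *: 'X - 1 : {poly algC}) = 2%N.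
  by rewrite size_polyDl size_scale // ?size_polyX // size_polyN size_poly1.
have l2 : lead_coef (z^* *: 'X - 1 : {poly algC}) = z^*.
  by rewrite lead_coefE sz2 !coefE subr0 mulr1.
rewrite [p * ('X - _) * _]mulrAC (sumsq_reciprocal_factor (p := p * \prod_(y <- s) ('X - y%:P))).
  have -> : max1 z = `|z| by apply/max_r.
  rewrite [p * _ * (_ - 1)]mulrAC exprMn mulrA -exprMn.
  have := IH (p * (z^* *: 'X - 1)); rewrite lead_coefM l2 normrM norm_conjC; apply.
    by rewrite mulf_neq0.
  by rewrite size_mul // sz2 addn2 /= addSn -addnS.
have m0 : \prod_(y <- s) ('X - y%:P) != 0 :> {poly algC} by rewrite monic_neq0 ?monic_prod_XsubC.
rewrite size_mul // size_prod_XsubC addnS /=.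
by move: le_n; rewrite /= addnS.
Qed.

(** The roots of [g] are among those of [f], and [f] has leading coefficient 1. *)
Lemma mahler_factor_le (f g h : {poly int}) : f \is monic -> g \is monic -> f = h * g ->
  mahler g ^+ 2 <= (\sum_(i < size f) f`_i ^+ 2)%:~R.
Proof.
move=> mf mg Df.
have mh : h \is monic.
  by rewrite monicE; have /monicP := mf; rewrite Df lead_coefM (monicP mg) mulr1 => ->.
have Ef : pC f = \prod_(z <- zroots h ++ zroots g) ('X - z%:P).
  by rewrite Df rmorphM /= !zroots_factor // big_cat.
have := @sumsq_ge_lead_mahler (zroots h ++ zroots g) 1%R (size f) (oner_neq0 _).
have -> : (size (1 : {poly algC})%R + size (zroots h ++ zroots g))%N = size f.
  rewrite size_poly1 size_cat !size_zroots // Df size_mul ?monic_neq0 //.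
  have sg : (0 < size g)%N by rewrite size_poly_gt0 monic_neq0.
  have sh : (0 < size h)%N by rewrite size_poly_gt0 monic_neq0.
  by move: sg sh; case: (size g) => // a _; case: (size h) => // b _; rewrite addSn addnS.
rewrite leqnn lead_coef1 normr1 expr1n !mul1r -Ef => /(_ isT) le.
rewrite rmorph_sum /=.
apply: le_trans (_ : (\prod_(z <- zroots h ++ zroots g) max1 z) ^+ 2 <= _); last first.
  apply: le_trans le _; apply: ler_sum => i _; rewrite coef_map /= rmorphXn /= -normrX.
  by rewrite ger0_norm // -rmorphXn /= ler0z sqr_ge0.
rewrite lerXn2r ?nnegrE ?(le_trans ler01 (mahler_ge1 _)) //.
  by apply: prodr_ge0 => z _; apply: max1_ge0.
by rewrite big_cat ler_peMl ?(le_trans ler01 (mahler_ge1 _)) ?(mahler_ge1 h).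
Qed.

(** * A quantitative form of Kronecker's theorem *)

(** The Graeffe transform, whose roots are the squares of the roots. *)
Definition graeffe (g : {poly int}) : {poly int} :=
  (-1) ^+ (size g).-1 *: (even_poly g ^+ 2 - 'X * odd_poly g ^+ 2).

Lemma comp_polyX2_inj (R : comNzRingType) : injective (fun p : {poly R} => p \Po 'X^2).
Proof.
move=> p q /polyP E; apply/polyP => i; have := E (i * 2)%N.
by rewrite !coef_comp_poly_Xn // dvdn_mull // mulnK.
Qed.

(** Over F_2 this reads G(x ^ 2) = g(x) ^ 2 = g(x ^ 2), so that G = g. *)
Lemma graeffe_comp (g : {poly int}) :
  graeffe g \Po 'X^2 = (-1) ^+ (size g).-1 *: (g * (g \Po - 'X)).
Proof.
rewrite comp_polyZ; congr (_ *: _).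
rewrite comp_polyB !expr2 !comp_polyM comp_polyX.
have := poly_even_odd g; move: (even_poly g) (odd_poly g) => a b <-.
rewrite comp_polyD comp_polyM -!comp_polyA comp_polyX.
have -> : 'X^2 \Po (- 'X) = 'X^2 :> {poly int} by rewrite expr2 comp_polyM comp_polyX; ring.
by move: (a \Po _) (b \Po _) => u v; rewrite -expr2; ring.
Qed.

Lemma graeffe_factor (g : {poly int}) (s : seq algC) :
  pC g = \prod_(z <- s) ('X - z%:P) -> pC (graeffe g) = \prod_(z <- s) ('X - (z ^+ 2)%:P).
Proof.
move=> Eg; apply: comp_polyX2_inj.
have sg : (size g).-1 = size s by rewrite -(size_pC g) Eg size_prod_XsubC.
have -> : pC (graeffe g) \Po 'X^2 = pC (graeffe g \Po 'X^2).
  by rewrite map_comp_poly map_polyXn.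
rewrite graeffe_comp map_polyZ rmorphM /= map_comp_poly rmorphN /= map_polyX Eg sg.
have comp_prod (q : {poly algC}) (F : algC -> {poly algC}) :
    (\prod_(z <- s) F z) \Po q = \prod_(z <- s) (F z \Po q).
  exact: (big_morph (fun p => p \Po q) (fun a b => comp_polyM a b q) (comp_polyC 1 q)).
rewrite !comp_prod rmorphXn rmorphN1 -mul_polyC rmorphXn rmorphN1.
rewrite -prodr_const_seq -!big_split /=.
apply: eq_bigr => z _; rewrite !comp_polyB !comp_polyX !comp_polyC rmorphXn /=.
by ring.
Qed.

(** The Frobenius endomorphism of F_2[x], lifted to the integers. *)
Lemma sqr_poly_mod2 (p : {poly int}) : exists u, p ^+ 2 = (p \Po 'X^2) + 2%:Z *: u.
Proof.
elim/poly_ind: p => [|p c [u Du]].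
  by exists 0; rewrite comp_poly0 expr0n scaler0 addr0.
have [e De] : exists e : int, c ^+ 2 = c + 2 * e.
  have := divz_eq c 2; have := @modz_ge0 c 2 isT; have := @ltz_pmod c 2 isT.
  move: (c %% 2)%Z (c %/ 2)%Z => r a lt_r ge_r ->.
  have [->|->] : r = 0 \/ r = 1 by lia.
  - by exists (a * (a * 2 - 1)); ring.
  - by exists (a * (a * 2 + 1)); ring.
exists (u * 'X^2 + c%:P * p * 'X + e%:P).
rewrite comp_poly_MXaddC sqrrD exprMn Du -polyC_exp De polyCD polyCM -!mul_polyC.
by rewrite -[2%:Z%:P]/(2%:R%:P) polyCMn; ring.
Qed.

Lemma graeffe_congr2 (g : {poly int}) : exists u, graeffe g - g = 2%:Z *: u.
Proof.
have [e De] : exists e : int, (-1) ^+ (size g).-1 = 1 + 2 * e :> int.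
  by rewrite -signr_odd; case: odd; [exists (-1) | exists 0].
have := poly_even_odd g; rewrite /graeffe De.
move: (even_poly g) (odd_poly g) => a b <-.
have [u Du] := sqr_poly_mod2 a; have [v Dv] := sqr_poly_mod2 b.
exists (u - 'X * v + e%:P * (a ^+ 2 - 'X * b ^+ 2) - 'X * (b \Po 'X^2)).
rewrite -!mul_polyC polyCD polyCM Du Dv -!mul_polyC.
by rewrite -[2%:Z%:P]/(2%:R%:P) polyCMn; ring.
Qed.

(** Squaring the even and odd parts gains a factor two. *)
Lemma graeffe_congrS (g h : {poly int}) (t : nat) : (0 < t)%N -> size g = size h ->
  (exists u, g - h = (2 ^ t)%:Z *: u) ->
  exists u, graeffe g - graeffe h = (2 ^ t.+1)%:Z *: u.
Proof.
move=> t_gt0 sgh [u /eqP]; rewrite subr_eq => /eqP Dg.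
rewrite /graeffe sgh Dg -scalerBr !linearD !linearZ /=.
move: (even_poly h) (odd_poly h) (even_poly u) (odd_poly u) => a b c d.
exists ((-1) ^+ (size h).-1 *: (c * a - 'X * (b * d)
  + (2 ^ t.-1)%:Z *: (c ^+ 2 - 'X * d ^+ 2))).
move: ((-1) ^+ _) => s.
have -> : (2 ^ t)%:Z = 2 * (2 ^ t.-1)%:Z by rewrite -PoszM -expnS prednK.
have -> : (2 ^ t.+1)%:Z = 4 * (2 ^ t.-1)%:Z.
  by rewrite -[4]/((2 ^ 2)%N%:Z) -PoszM -expnD -addn2 -{1}(prednK t_gt0) addSn -addnS addnC.
rewrite -!mul_polyC !polyCM; move: (2 ^ t.-1)%:Z%:P => w.
have -> : (2 : int)%:P = 2%:R by rewrite -[2]/(2%:R) polyCMn.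
have -> : (4 : int)%:P = 4%:R by rewrite -[4]/(4%:R) polyCMn.
by ring.
Qed.

Section GraeffeIterates.

Variable g : {poly int}.
Hypothesis g_monic : g \is monic.

Lemma graeffe_iter_factor k :
  pC (iter k graeffe g) = \prod_(z <- zroots g) ('X - (z ^+ (2 ^ k))%:P).
Proof.
elim: k => [|k IH]; first by rewrite /= zroots_factor.
have := IH; rewrite -(big_map (fun z => z ^+ (2 ^ k)) predT (fun z => 'X - z%:P)).
move=> /graeffe_factor /= ->; rewrite big_map; apply: eq_bigr => z _.
by rewrite -exprM -expnSr.
Qed.

Lemma size_graeffe_iter k : size (iter k graeffe g) = size g.
Proof.
rewrite -!(size_pC) graeffe_iter_factor zroots_factor //.
by rewrite -(big_map (fun z => z ^+ (2 ^ k)) predT (fun z => 'X - z%:P))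
   !size_prod_XsubC size_map.
Qed.

Lemma graeffe_iter_congr k :
  exists u, iter k.+1 graeffe g - iter k graeffe g = (2 ^ k.+1)%:Z *: u.
Proof.
elim: k => [|k IH]; first exact: graeffe_congr2.
by apply: graeffe_congrS => //; rewrite (size_graeffe_iter k.+1) size_graeffe_iter.
Qed.

End GraeffeIterates.

(** The sum of the moduli of the coefficients is at most the product of the
    [1 + |z|], and [1 + |z| <= 2 * max1 z]. *)
Lemma coef_prod_XsubC_le (s : seq algC) i :
  `|(\prod_(z <- s) ('X - z%:P))`_i| <= (2 ^ size s)%:R * \prod_(z <- s) max1 z.
Proof.
elim: s i => [|z s IH] i.
  by rewrite !big_nil coef1 expn0 mulr1; case: (i == 0)%N; rewrite ?normr1 ?normr0.
rewrite !big_cons mulrBl coefB coefXM coefCM.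
set B := _ * _ in IH; have B0 : 0 <= B := le_trans (normr_ge0 _) (IH 0%N).
have -> : (2 ^ size (z :: s))%:R * (max1 z * \prod_(j <- s) max1 j) = max1 z * B + max1 z * B.
  by rewrite /B /= expnS natrM; ring.
apply: le_trans (ler_normB _ _) _; apply: lerD.
  apply: le_trans (_ : B <= _); first by case: eqP => // _; rewrite normr0.
  by rewrite ler_peMl // max1_ge1.
by rewrite normrM ler_pM // max1_norm.
Qed.

(** The iterated squares of [w] stay in a finite set, so two of them agree. *)
Lemma orbit_squaring_finite (W : seq algC) (w : algC) :
  (forall x, x \in W -> x ^+ 2 \in W) -> w \in W -> w != 0 ->
  exists2 k, (0 < k)%N & w ^+ k = 1.
Proof.
move=> sqW wW w0.
have orbW i : w ^+ (2 ^ i) \in W.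
  by elim: i => [|i IH] //; rewrite expnSr exprM sqW.
have : ~~ uniq [seq w ^+ (2 ^ i) | i <- iota 0 (size W).+1].
  apply/negP => u; have : (size [seq w ^+ (2 ^ i) | i <- iota 0 (size W).+1] <= size W)%N.
    by apply: uniq_leq_size => // x /mapP[i _ ->].
  by rewrite size_map size_iota ltnn.
move=> /(uniqPn 0)[i [j [lt_ij lt_j]]]; rewrite size_map size_iota in lt_j.
rewrite !(nth_map 0%N) ?size_iota ?(ltn_trans lt_ij) // !nth_iota ?(ltn_trans lt_ij) //.
rewrite !add0n => E; exists (2 ^ j - 2 ^ i)%N; first by rewrite subn_gt0 ltn_exp2l.
apply: (mulfI (expf_neq0 (2 ^ i) w0)).
by rewrite -exprD subnKC ?mulr1 // leq_exp2l // ltnW.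
Qed.

(** Kronecker's theorem in quantitative form. Consecutive Graeffe transforms
    [iter k graeffe g] are congruent modulo a growing power of two; while their
    Mahler measure stays at most [2], their coefficients are bounded, so two
    consecutive ones coincide, and the roots form a finite set which is stable
    under squaring. *)
Lemma kronecker_effective (g : {poly int}) (n : nat) (z : algC) :
  g \is monic -> size g = n.+1 -> mahler g ^+ (2 ^ n.+3) <= 2 ->
  root (pC g) z -> z != 0 -> exists2 k, (0 < k)%N & z ^+ k = 1.
Proof.
move=> mg sg small gz z0.
have szr : size (zroots g) = n by rewrite size_zroots ?sg.
have coef_le k i : (k <= n.+3)%N -> `|((iter k graeffe g)`_i)%:~R : algC| <= (2 ^ n.+1)%:R.
  move=> le_k; rewrite -coef_map /= graeffe_iter_factor //.
  rewrite -(big_map (fun z => z ^+ (2 ^ k)) predT (fun z => 'X - z%:P)).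
  apply: le_trans (coef_prod_XsubC_le _ _) _.
  rewrite size_map szr expnSr natrM ler_pM2l ?ltr0n ?expn_gt0 //.
  rewrite big_map; under eq_bigr do rewrite max1X.
  rewrite prodrXl; apply: le_trans small.
  by rewrite ler_weXn2l ?mahler_ge1 // leq_exp2l.
have Eg : iter n.+3 graeffe g = iter n.+2 graeffe g.
  have [u Du] := graeffe_iter_congr mg n.+2.
  apply/eqP; rewrite -subr_eq0; apply/eqP/polyP => i.
  rewrite coef0; apply/eqP/negPn/negP => nz.
  have : `|((iter n.+3 graeffe g - iter n.+2 graeffe g)`_i)%:~R : algC| <= (2 ^ n.+2)%:R.
    rewrite coefB rmorphB /=; apply: le_trans (ler_normB _ _) _.
    have -> : (2 ^ n.+2)%:R = (2 ^ n.+1)%:R + (2 ^ n.+1)%:R :> algC.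
      by rewrite -natrD addnn -muln2 -expnSr.
    exact: lerD (coef_le n.+3 i (leqnn _)) (coef_le n.+2 i (leqnSn _)).
  rewrite Du coefZ in nz *; rewrite rmorphM normrM /= normr_nat.
  apply/negP; rewrite -real_ltNge ?realE ?mulr_ge0 ?ler0n //.
  apply: lt_le_trans (_ : (2 ^ n.+3)%:R <= _); first by rewrite ltr_nat ltn_exp2l.
  rewrite ler_peMr // norm_intr_ge1 ?intr_int // intr_eq0.
  by apply: contraNneq nz => ->; rewrite mulr0.
pose W := [seq y ^+ (2 ^ n.+2) | y <- zroots g].
have WE k x : root (pC (iter k graeffe g)) x = (x \in [seq y ^+ (2 ^ k) | y <- zroots g]).
  rewrite graeffe_iter_factor // -(big_map (fun z => z ^+ (2 ^ k)) predT (fun z => 'X - z%:P)).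
  by rewrite root_prod_XsubC.
have sqW x : x \in W -> x ^+ 2 \in W.
  move=> /mapP[y yg ->]; rewrite -WE -Eg WE -exprM -expnSr.
  by apply/mapP; exists y.
have wW : z ^+ (2 ^ n.+2) \in W by apply/mapP; exists z; rewrite -?root_zroots.
have [k k_gt0 wk] := orbit_squaring_finite sqW wW (expf_neq0 _ z0).
by exists (2 ^ n.+2 * k)%N; [rewrite muln_gt0 expn_gt0 | rewrite exprM].
Qed.

(** The largest root is at least the geometric mean of the [max1 z]. *)
Lemma large_root_exists (g : {poly int}) (n e : nat) : g \is monic -> size g = n.+1 ->
  (0 < n)%N -> 2 < mahler g ^+ e ->
  exists2 z, root (pC g) z & 2 <= `|z| ^+ (n * e).
Proof.
move=> mg sg n_gt0 big.
have [/hasP[z zg le]|] := boolP (has (fun z => 2 <= `|z| ^+ (n * e)) (zroots g)).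
  by exists z; rewrite ?root_zroots.
move=> /hasPn small; exfalso; move: big; apply/negP.
have m0 : 0 <= mahler g by apply: le_trans (mahler_ge1 g); rewrite ler01.
rewrite -real_leNgt ?realE ?ler0n ?exprn_ge0 //.
rewrite -(ler_pXn2r n_gt0) ?nnegrE ?exprn_ge0 ?ler0n // -exprM mulnC.
have -> : 2 ^+ n = \prod_(z <- zroots g) (2 : algC).
  by rewrite prodr_const_seq size_zroots ?sg.
rewrite /mahler -prodrXl big_seq [leRHS]big_seq; apply: ler_prod => z zg.
rewrite exprn_ge0 ?max1_ge0 //= -max1X.
have := small z zg; rewrite -real_ltNge ?realE ?ler0n ?exprn_ge0 // => lt2.
have cmp : 1 >=< `|z ^+ (n * e)| by rewrite real_comparable ?realE ?ler01 ?normr_ge0.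
by rewrite /max1 comparable_ge_max // ler1n /= normrX ltW.
Qed.

(** * Anticoncentration of sums of uniform digits *)

(** The middle binomial coefficient of order n is at most 2 ^ n / (n + 1) ^ (1 / 2).
    Off the diagonal the induction decreases the larger index, on the diagonal
    both. *)
Lemma bin_sqr_le a b : ('C(a + b, a) ^ 2 * (a + b).+1 <= 4 ^ (a + b))%N.
Proof.
wlog le_ab : a b / (a <= b)%N.
  move=> H; have [/H//|/ltnW/H] := leqP a b.
  by rewrite addnC -bin_sub ?leq_addl // addnK.
have [m] := ubnP (a + b); elim: m => // m IH in a b le_ab *; rewrite ltnS => le_m.
have [lt_ab|ge_ab] := ltnP a b.
  (* from (a, b - 1): the ratio is n (n + 1) / b ^ 2 <= 4, as n + 1 <= 2 b *)
  case: b lt_ab le_ab le_m => // b lt_ab _; rewrite addnS ltnS in lt_ab * => le_m.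
  have := IH a b lt_ab le_m; have := mul_bin_down (a + b).+1 a.
  rewrite /= -addnS addKn addnS; move: 'C(a + b, a) 'C((a + b).+1, a) => x y E le.
  have le_n : ((a + b).+1 < b.+1 * 2)%N by lia.
  rewrite -(leq_pmul2r (_ : 0 < b.+1 ^ 2)%N) ?expn_gt0 //.
  have -> : (y ^ 2 * (a + b).+2 * b.+1 ^ 2 = (b.+1 * y) ^ 2 * (a + b).+2)%N by ring.
  rewrite -E [(4 ^ _.+1)%N]expnS; have -> : (((a + b).+1 * x) ^ 2 * (a + b).+2 =
     (x ^ 2 * (a + b).+1) * ((a + b).+1 * (a + b).+2))%N by ring.
  have -> : (4 * 4 ^ (a + b) * b.+1 ^ 2 = 4 ^ (a + b) * (b.+1 * 2 * (b.+1 * 2)))%N by ring.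
  by rewrite leq_mul // leq_mul // ltnW.
have ba : b = a by apply/eqP; rewrite eqn_leq le_ab ge_ab.
rewrite {b le_ab ge_ab}ba in le_m *.
case: a => [|a] in le_m *; first by [].
have le_m' : (a + a < m)%N by lia.
have := IH a a (leqnn a) le_m'.
have := mul_bin_down (a + a).+1 a; have := mul_bin_diag (a + a).+2 a.
rewrite /= -addnS addKn addSn addnS /=.
move: 'C((a + a).+1, a) 'C((a + a).+2, a.+1) 'C(a + a, a) => x y w E1 E2 le.
have E : (a.+1 * y = 2 * (a + a).+1 * w)%N.
  have H : (a.+1 * (a.+1 * y) = a.+1 * (2 * (a + a).+1 * w))%N.
    rewrite -E1 mulnCA -E2; have -> : ((a + a).+2 = 2 * a.+1)%N by lia.
    by ring.
  by move/eqP: H; rewrite eqn_pmul2l // => /eqP.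
rewrite -(leq_pmul2r (_ : 0 < a.+1 ^ 2)%N) ?expn_gt0 //.
have -> : (y ^ 2 * (a + a).+3 * a.+1 ^ 2 = (a.+1 * y) ^ 2 * (a + a).+3)%N by ring.
rewrite E ![(4 ^ _.+1)%N]expnS.
have -> : ((2 * (a + a).+1 * w) ^ 2 * (a + a).+3 =
   w ^ 2 * (a + a).+1 * (4 * (a + a).+1 * (a + a).+3))%N by ring.
have -> : (4 * (4 * 4 ^ (a + a)) * a.+1 ^ 2 = 4 ^ (a + a) * (16 * a.+1 ^ 2))%N by ring.
by rewrite leq_mul //; nia.
Qed.

(** Expand the sum of the [w i * (W * x i - M) ^ 2], where [W] is the sum of the
    weights and [M] that of the [w i * x i]. *)
Lemma weighted_cauchy_schwarz (F : realFieldType) (I : finType) (w x : I -> F) :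
  (forall i, 0 <= w i) ->
  (\sum_i w i * x i) ^+ 2 <= (\sum_i w i) * (\sum_i w i * x i ^+ 2).
Proof.
move=> w0; set W := \sum_i w i; set M := \sum_i _; set S := \sum_i _.
have [W0|/eqP Wn0] := eqVneq W 0.
  have wi0 i : w i = 0.
    have /psumr_eq0P := W0; apply=> // j _; exact: w0.
  rewrite W0 mul0r /M big1 ?expr0n // => i _; first by rewrite wi0 mul0r.
have Wp : 0 < W by rewrite lt_def sumr_ge0 // andbT; apply/eqP.
have : 0 <= \sum_i w i * (W * x i - M) ^+ 2.
  by apply: sumr_ge0 => i _; rewrite mulr_ge0 // sqr_ge0.
have -> : \sum_i w i * (W * x i - M) ^+ 2 = W * (W * S - M ^+ 2).
  rewrite (eq_bigr (fun i => W ^+ 2 * (w i * x i ^+ 2) - (W * M * 2) * (w i * x i)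
                             + M ^+ 2 * w i)); last by move=> i _; ring.
  by rewrite big_split sumrB -!mulr_sumr -/W -/S -/M /=; ring.
by rewrite pmulr_rge0 // subr_ge0.
Qed.

Lemma coefM_nneg_le (F : realFieldType) (p q : {poly F}) (m : F) c : 0 <= m ->
  (forall i, `|p`_i| <= m) -> (forall i, 0 <= q`_i) -> `|(p * q)`_c| <= m * q.[1].
Proof.
move=> m0 pm q0; rewrite coefMr; apply: le_trans (ler_norm_sum _ _ _) _.
apply: le_trans (_ : \sum_(i < c.+1) m * q`_i <= _).
  by apply: ler_sum => i _; rewrite normrM ler_pM // ger0_norm.
rewrite -mulr_sumr ler_wpM2l //.
rewrite (@horner_coef_wide _ (maxn (size q) c.+1)) ?leq_maxl //.
under [leRHS]eq_bigr do rewrite expr1n mulr1.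
rewrite -(big_mkord xpredT (fun i => q`_i)) -[leRHS](big_mkord xpredT (fun i => q`_i)).
rewrite [leRHS](big_cat_nat (leq0n c.+1) (leq_maxr _ _)) /= lerDl.
by rewrite sumr_ge0.
Qed.

(** Writing 1 + x + ... + x ^ (2 K) = 1 + (1 + x) (x + x ^ 3 + ... + x ^ (2 K - 1))
    turns the D-th power into a mixture of binomial distributions, whose
    maximal weights are of order j ^ (- 1 / 2); the average of 1 / (j + 1) for
    a binomial distribution is explicit. *)
Lemma coef_interval_power_le (K D c : nat) : (0 < K)%N ->
  2 * ((\sum_(t < K.*2.+1) 'X^t : {poly rat}) ^+ D)`_c ^+ 2 * D.+1%:R
    <= 3 * (K.*2.+1)%:R ^+ D ^+ 2.
Proof.
move=> K_gt0; set Q : rat := (K.*2.+1)%:R.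
have Q0 : 0 < Q by rewrite ltr0n.
pose B : {poly rat} := \sum_(j < K) 'X^(j.*2.+1).
have -> : \sum_(t < K.*2.+1) 'X^t = 1 + (1 + 'X) * B :> {poly rat}.
  rewrite /B; elim: (K) => [|k IH]; first by rewrite big_ord1 big_ord0 mulr0 addr0.
  rewrite doubleS big_ord_recr big_ord_recr /= IH [in RHS]big_ord_recr /=.
  by rewrite [in X in _ + X = _]exprS; move: ('X^_) => y; ring.
have B0 j i : 0 <= (B ^+ j)`_i.
  elim: j i => [|j IH] i; first by rewrite expr0 coef1 ler0n.
  rewrite exprSr coefM sumr_ge0 // => k _; rewrite mulr_ge0 // /B coef_sum.
  by rewrite sumr_ge0 // => l _; rewrite coefXn ler0n.
have B1 j : (B ^+ j).[1] = K%:R ^+ j.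
  rewrite horner_exp; congr (_ ^+ _); rewrite horner_sum.
  under eq_bigr do rewrite hornerXn expr1n.
  by rewrite sumr_const card_ord.
pose mb j := (\max_(i < j.+1) 'C(j, i))%N.
have mb_le j i : ('C(j, i) <= mb j)%N.
  have [le_ij|lt_ji] := leqP i j; last by rewrite bin_small.
  by rewrite -[i]/(val (Ordinal (le_ij : (i < j.+1)%N))); apply: leq_bigmax.
have mb_sqr j : (mb j ^ 2 * j.+1 <= 4 ^ j)%N.
  have [i Ei] : {i : 'I_j.+1 | mb j = 'C(j, i)} by apply: bigop.eq_bigmax; rewrite card_ord.
  rewrite Ei; have := bin_sqr_le i (j - i); rewrite subnKC //.
  by rewrite -ltnS.
pose x j : rat := (mb j)%:R / 2 ^+ j.
have x_sqr j : x j ^+ 2 <= j.+1%:R^-1.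
  rewrite -[leRHS]mul1r ler_pdivlMr ?ltr0n // /x expr_div_n mulrAC ler_pdivrMr ?exprn_gt0 // mul1r.
  by rewrite -exprM mulnC exprM -!natrX -natrM ler_nat.
have coef_le j : `|((1 + 'X) ^+ j * B ^+ j)`_c| <= (2 * K%:R) ^+ j * x j.
  have -> : (2 * K%:R) ^+ j * x j = (mb j)%:R * (B ^+ j).[1].
    have n0 : 2 ^+ j != 0 :> rat by rewrite expf_neq0.
    by rewrite B1 /x exprMn; move: (2 ^+ j) n0 (K%:R ^+ j) => a a0 k; field.
  apply: coefM_nneg_le => // i.
  rewrite exprDn coef_sum; under eq_bigr do rewrite expr1n mul1r coefMn coefXn.
  have [le_ij|lt_ji] := leqP i j.
    rewrite (bigD1 (Ordinal (le_ij : (i < j.+1)%N))) //= eqxx big1 => [|k ki].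
      by rewrite addr0 normr_nat ler_nat.
    by rewrite (_ : (i == k) = false) ?mul0rn //; apply: contraNF ki => /eqP ik; apply/eqP/val_inj.
  rewrite big1 ?normr0 // => k _; rewrite (_ : (i == k) = false) ?mul0rn //.
  by apply/negP => /eqP ik; move: lt_ji; rewrite ik ltnNge -ltnS ltn_ord.
pose w (j : 'I_D.+1) : rat := 'C(D, j)%:R * (2 * K%:R) ^+ j.
have w0 j : 0 <= w j by rewrite mulr_ge0 ?exprn_ge0 ?mulr_ge0.
have QE : Q = 1 + 2 * K%:R by rewrite /Q -addn1 natrD -muln2 natrM mulrC addrC.
have W1 : \sum_j w j = Q ^+ D.
  rewrite QE exprDn; apply: eq_bigr => j _.
  by rewrite expr1n mul1r /w mulr_natl.
have Wx : \sum_j w j * x j ^+ 2 <= 3 / 2 * Q ^+ D / D.+1%:R.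
  apply: le_trans (_ : \sum_(j < D.+1) w j / j.+1%:R <= _).
    by apply: ler_sum => j _; rewrite ler_wpM2l.
  rewrite ler_pdivlMr ?ltr0n //.
  have K2 : 0 < 2 * K%:R :> rat by rewrite mulr_gt0 ?ltr0n.
  rewrite -(ler_pM2r K2) !mulr_suml.
  have -> : \sum_(j < D.+1) w j / j.+1%:R * D.+1%:R * (2 * K%:R) =
      \sum_(j < D.+1) (2 * K%:R) ^+ j.+1 *+ 'C(D.+1, j.+1).
    apply: eq_bigr => j _; rewrite /w exprSr -[RHS]mulr_natl.
    have /(congr1 (fun n => n%:R : rat)) := mul_bin_diag D.+1 j; rewrite !natrM /= => E.
    have j0 : (j.+1%:R : rat) != 0 by rewrite pnatr_eq0.
    have -> : 'C(D.+1, j.+1)%:R = D.+1%:R * 'C(D, j)%:R / j.+1%:R :> rat.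
      by rewrite E mulrAC mulfV // mul1r.
    by ring.
  apply: le_trans (_ : Q ^+ D.+1 <= _).
    rewrite QE exprDn [leRHS]big_ord_recl /=; apply: ler_wpDl.
      by rewrite expr1n mul1r expr0 mulrn_wge0.
    by apply: ler_sum => j _; rewrite expr1n mul1r.
  have K1 : 1 <= K%:R :> rat by rewrite ler1n.
  rewrite exprS QE mulrC mulrAC mulrC ler_wpM2r ?exprn_ge0 ?addr_ge0 ?mulr_ge0 //.
  by lra.
apply: le_trans (_ : 2 * (\sum_j w j * x j) ^+ 2 * D.+1%:R <= _).
  rewrite ler_wpM2r // ler_wpM2l // -real_normK ?num_real //.
  rewrite lerXn2r ?nnegrE ?sumr_ge0 //.
    by move=> j _; rewrite mulr_ge0 // /x divr_ge0 ?exprn_ge0.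
  rewrite exprDn coef_sum; apply: le_trans (ler_norm_sum _ _ _) _.
  apply: ler_sum => j _; rewrite expr1n mul1r exprMn coefMn normrMn.
  rewrite /w -mulrA -[leLHS]mulr_natl ler_wpM2l // -exprMn; exact: coef_le.
have := weighted_cauchy_schwarz (fun j : 'I_D.+1 => x j) w0; rewrite W1 => le.
have D0 : 0 < D.+1%:R :> rat by rewrite ltr0n.
rewrite -ler_pdivlMr //; move: le Wx; set M := _ ^+ 2; set S := \sum_j _ => le Wx.
have le' : M <= Q ^+ D * (3 / 2 * Q ^+ D / D.+1%:R).
  by apply: le_trans le _; rewrite ler_wpM2l // exprn_ge0 // ltW.
have -> : 3 * Q ^+ D ^+ 2 / D.+1%:R = 2 * (Q ^+ D * (3 / 2 * Q ^+ D / D.+1%:R)).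
  by move: (Q ^+ D) D.+1%:R (lt0r_neq0 D0) => a b b0; field.
by rewrite ler_wpM2l.
Qed.

(** * Counting the digit sequences whose polynomial vanishes at a point *)

Definition agree_off (I : finType) (T : eqType) (S : {set I}) (v w : {ffun I -> T}) :=
  [forall (i | i \notin S), v i == w i].

Lemma agree_offP (I : finType) (T : eqType) (S : {set I}) (v w : {ffun I -> T}) :
  reflect (forall i, i \notin S -> v i = w i) (agree_off S v w).
Proof. by apply: (iffP forall_inP) => H i /H/eqP. Qed.

(** Conditioning on the coordinates outside [S]. *)
Lemma card_le_fibers (I : finType) (q : nat) (S : {set I})
    (A : {set {ffun I -> 'I_q.+1}}) (c : nat) :
  (forall v, (#|[set w in A | agree_off S w v]| <= c)%N) ->
  (#|A| * q.+1 ^ #|S| <= c * q.+1 ^ #|I|)%N.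
Proof.
move=> fib.
(* a fiber is labelled by its restriction to the complement of S, extended by 0 *)
pose rest (v : {ffun I -> 'I_q.+1}) := [ffun i => if i \in S then ord0 else v i].
suff le : (#|A| <= c * q.+1 ^ #|~: S|)%N.
  apply: leq_trans (leq_mul le (leqnn _)) _.
  by rewrite -mulnA -expnD addnC cardsC.
pose D := pffun_on (ord0 : 'I_q.+1) (mem (~: S)) predT.
have cD : #|D| = (q.+1 ^ #|~: S|)%N by rewrite card_pffun_on card_ord.
have restD v : rest v \in D.
  apply/pffun_onP; split=> [|//]; apply/supportP => i.
  by rewrite inE negbK ffunE => ->.
rewrite -cD mulnC -sum_nat_const -sum1_card.
rewrite (partition_big rest (mem D)) /=; last by move=> v _; apply: restD.
apply: leq_sum => w _; apply: leq_trans (fib w).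
rewrite sum1dep_card subset_leq_card //; apply/fintype.subsetP => v.
rewrite !inE => /andP[-> /eqP <-]; apply/agree_offP => i iS.
by rewrite ffunE (negPf iS).
Qed.

(** The count is a coefficient of the generating function of the sum of [#|S|]
    uniform digits, to which [coef_interval_power_le] applies. *)
Lemma sum_on_card_le (I : finType) (K : nat) (S : {set I})
    (v0 : {ffun I -> 'I_K.*2.+1}) (c : nat) : (0 < K)%N ->
  (2 * #|[set v : {ffun I -> 'I_K.*2.+1} | agree_off S v v0 & (\sum_(i in S) v i == c)%N]| ^ 2
     * #|S|.+1 <= 3 * (K.*2.+1 ^ #|S|) ^ 2)%N.
Proof.
move=> K_gt0; set A := [set v | _].
pose F (i : I) (t : 'I_K.*2.+1) : {poly rat} :=
  if i \in S then 'X^t else ((t == v0 i)%:R)%:P.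
have prodF (v : {ffun I -> 'I_K.*2.+1}) :
    \prod_i F i (v i) = (agree_off S v v0)%:R *: 'X^(\sum_(i in S) v i).
  rewrite (bigID (mem S)) /= mulrC.
  rewrite (eq_bigr (fun i => ((v i == v0 i)%:R)%:P)); last first.
    by move=> i iS; rewrite /F (negPf iS).
  rewrite [X in _ * X](eq_bigr (fun i => 'X^(v i))); last by move=> i iS; rewrite /F iS.
  rewrite prodrXr -mul_polyC; congr (_ * _).
  case: agree_offP => [H|H].
    by rewrite big1 // => i iS; rewrite H // eqxx.
  have [i iS ne] : exists2 i, i \notin S & v i != v0 i.
    apply/exists_inP; rewrite -negb_forall_in; apply/negP => /forall_inP H'.
    by apply: H => i /H'/eqP.
  by rewrite (bigD1 i) //= (negPf ne) polyC0 mul0r.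
have E : (\sum_(t < K.*2.+1) 'X^t : {poly rat}) ^+ #|S| =
    \sum_(v : {ffun I -> 'I_K.*2.+1}) (agree_off S v v0)%:R *: 'X^(\sum_(i in S) v i).
  rewrite -(eq_bigr _ (fun v _ => prodF v)) -bigA_distr_bigA (bigID (mem S)) /=.
  rewrite [X in _ * X]big1 ?mulr1; last first.
    move=> i iS; rewrite (bigD1 (v0 i)) //= /F (negPf iS) eqxx big1 ?addr0 // => t ne.
    by rewrite (negPf ne).
  rewrite -prodr_const; apply: eq_bigr => i iS.
  by apply: eq_bigr => t _; rewrite /F iS.
have := coef_interval_power_le #|S| c K_gt0; rewrite E coef_sum.
have -> : \sum_(v : {ffun I -> 'I_K.*2.+1})
    ((agree_off S v v0)%:R *: 'X^(\sum_(i in S) v i) : {poly rat})`_c = #|A|%:R.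
  rewrite -sum1_card natr_sum [RHS]big_mkcond /=; apply: eq_bigr => v _.
  rewrite coefZ coefXn inE eq_sym; case: agree_off; rewrite ?mul1r ?mul0r //=.
  by case: eqP.
by rewrite -!natrX -!natrM ler_nat.
Qed.

Section RandomPolynomial.

Variables d K : nat.
Local Notation Q := K.*2.+1.
Implicit Types v w : {ffun 'I_d -> 'I_Q}.

(** A digit between 0 and 2 K encodes a coefficient between - K and K. *)
Definition digit_coef v (i : 'I_d) : int := (v i)%:Z - K%:Z.

Definition digit_poly v : {poly int} :=
  'X^d + \sum_(i < d) (digit_coef v i)%:P * 'X^i.

Definition vanishing (z : algC) := [set v | root (pC (digit_poly v)) z].

Lemma coef_digit_sum (c : 'I_d -> int) (j : nat) :
  (\sum_(i < d) (c i)%:P * 'X^i)`_j = if insub j is Some i then c i else 0.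
Proof.
rewrite coef_sum; under eq_bigr do rewrite coefCM coefXn.
case: insubP => [i _ ij|ge].
  rewrite (bigD1 i) //= ij eqxx mulr1 big1 ?addr0 // => k ne.
  by rewrite -ij (_ : (_ == _) = false) ?mulr0 //; apply: contraNF ne => /eqP/val_inj->.
rewrite big1 // => i _; rewrite (_ : (_ == _) = false) ?mulr0 //.
by apply: contraNF ge => /eqP->.
Qed.

Lemma size_digit_sum (c : 'I_d -> int) (n : nat) :
  (forall i : 'I_d, (n <= i)%N -> c i = 0) ->
  (size (\sum_(i < d) (c i)%:P * 'X^i)%R <= n)%N.
Proof.
move=> c0; apply/leq_sizeP => j le_nj; rewrite coef_digit_sum.
by case: insubP => // i _ ij; apply: c0; rewrite ij.
Qed.

Lemma horner_digit_sum (c : 'I_d -> int) (z : algC) :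
  (pC (\sum_(i < d) (c i)%:P * 'X^i)).[z] = \sum_(i < d) (c i)%:~R * z ^+ i.
Proof.
rewrite rmorph_sum horner_sum; apply: eq_bigr => i _ /=.
by rewrite rmorphM /= map_polyC map_polyXn /= hornerM hornerC hornerXn.
Qed.

Lemma size_digit_poly v : size (digit_poly v) = d.+1.
Proof.
rewrite /digit_poly size_polyDl size_polyXn // ltnS size_digit_sum // => i.
by rewrite leqNgt ltn_ord.
Qed.

Lemma digit_poly_monic v : digit_poly v \is monic.
Proof.
rewrite monicE lead_coefE size_digit_poly coefD coefXn eqxx coef_digit_sum.
by case: insubP => [i|_]; rewrite ?ltnn // addr0.
Qed.

Lemma coef_digit_poly v (i : 'I_d) : (digit_poly v)`_i = digit_coef v i.
Proof.
rewrite coefD coefXn (ltn_eqF (ltn_ord i)) add0r coef_digit_sum.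
by rewrite valK.
Qed.

Lemma digit_polyB v w : digit_poly v - digit_poly w =
  \sum_(i < d) ((v i)%:Z - (w i)%:Z)%:P * 'X^i.
Proof.
rewrite /digit_poly opprD addrACA subrr add0r -sumrB; apply: eq_bigr => i _.
by rewrite -mulrBl -polyCB /digit_coef; congr (_ %:P * _); lia.
Qed.

Lemma vanishingB z v w : v \in vanishing z -> w \in vanishing z ->
  root (pC (\sum_(i < d) ((v i)%:Z - (w i)%:Z)%:P * 'X^i)) z.
Proof.
rewrite !inE -digit_polyB rmorphB /= => /rootP vz /rootP wz.
by apply/rootP; rewrite hornerD hornerN vz wz subrr.
Qed.

Lemma digit_sum_inj v w (S : {set 'I_d}) : agree_off S v w ->
  (forall i, i \in S -> (\sum_(i < d) ((v i)%:Z - (w i)%:Z)%:P * 'X^i)`_i = 0) ->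
  v = w.
Proof.
move=> /agree_offP vw H; apply/ffunP => i; have [iS|/vw//] := boolP (i \in S).
have := H i iS; rewrite coef_digit_sum valK => /eqP; rewrite subr_eq0 => /eqP[].
exact: val_inj.
Qed.

Lemma card_le1_fiber (A : {set {ffun 'I_d -> 'I_Q}}) (S : {set 'I_d}) :
  (forall v w, v \in A -> w \in A -> agree_off S v w -> v = w) ->
  (#|A| * Q ^ #|S| <= Q ^ d)%N.
Proof.
move=> inj; have := @card_le_fibers _ K.*2 S A 1; rewrite card_ord mul1n; apply.
move=> u; apply/card_le1_eqP => v w.
rewrite !inE => /andP[vA /agree_offP vu] /andP[wA /agree_offP wu].
by apply: inj => //; apply/agree_offP => i iS; rewrite vu ?wu.
Qed.

Lemma vanishing_card_degree z n : (n <= d)%N ->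
  (forall u : {poly int}, u != 0 -> root (pC u) z -> (n < size u)%N) ->
  (#|vanishing z| * Q ^ n <= Q ^ d)%N.
Proof.
move=> le_nd deg_z.
have cS : #|[set i : 'I_d | (i < n)%N]| = n.
  have -> : [set i : 'I_d | (i < n)%N] = [set widen_ord le_nd j | j : 'I_n].
    apply/setP => i; rewrite inE; apply/idP/imsetP => [lt|[j _ ->]]; last exact: (ltn_ord j).
    by exists (Ordinal lt) => //; apply: val_inj.
  by rewrite card_imset ?card_ord // => i j /(congr1 val)/= /val_inj.
have := @card_le1_fiber (vanishing z) [set i : 'I_d | (i < n)%N].
rewrite cS; apply => v w vz wz vw; apply: digit_sum_inj (vw) _ => i _.
set u := \sum_(i < d) _; suff -> : u = 0 by rewrite coef0.
apply/eqP/negPn/negP => u0; have := deg_z u u0 (vanishingB vz wz).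
rewrite ltnNge size_digit_sum // => j le_nj.
by move/agree_offP: vw => ->; rewrite ?subrr // inE -leqNgt.
Qed.

(** Cauchy's bound: the leading term dominates a geometric series. *)
Lemma cauchy_root_bound (p : {poly int}) (B : nat) (y : algC) :
  (forall i, `|p`_i| <= B%:Z) -> B.+1%:R <= `|y| -> root (pC p) y -> p = 0.
Proof.
move=> le_B le_y py; apply/eqP/negPn/negP => p0.
have n_gt0 : (0 < size p)%N by rewrite size_poly_gt0.
set n := (size p).-1; set r := `|y|.
have r_ge1 : 1 <= r by apply: le_trans le_y; rewrite ler1n.
have r_ge0 : 0 <= r := normr_ge0 y.
have coefC i : `|(pC p)`_i| <= B%:R.
  by rewrite coef_map /= -intr_norm -[B%:R]/(B%:Z%:~R) ler_int.
have E : (pC p)`_n * y ^+ n = - \sum_(i < n) (pC p)`_i * y ^+ i.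
  apply/eqP; rewrite -subr_eq0 opprK addrC; apply/eqP.
  move/rootP: py; rewrite horner_coef size_pC -(prednK n_gt0) big_ord_recr /=.
  by [].
have lo : r ^+ n <= `|(pC p)`_n * y ^+ n|.
  rewrite normrM normrX ler_peMl ?exprn_ge0 //.
  rewrite norm_intr_ge1 ?coef_map ?intr_int //=.
  by rewrite intr_eq0 -lead_coefE lead_coef_eq0.
have hi : `|(pC p)`_n * y ^+ n| <= r ^+ n - 1.
  rewrite E normrN subrX1 mulr_sumr; apply: le_trans (ler_norm_sum _ _ _) _.
  apply: ler_sum => i _; rewrite normrM normrX ler_wpM2r ?exprn_ge0 //.
  by apply: le_trans (coefC i) _; rewrite lerBrDr -natr1 in le_y *.
have := le_trans lo hi; rewrite lerBrDr gerDl ler10.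
by [].
Qed.

Lemma card_multiples (L : nat) : (0 < L)%N -> (d <= L * #|[set i : 'I_d | (L %| i)%N]|)%N.
Proof.
move=> L_gt0; case: (posnP d) => [->//|d_gt0].
have lt j : (j < d.-1 %/ L + 1)%N -> (L * j < d)%N.
  rewrite addn1 ltnS => le; rewrite -(prednK d_gt0) ltnS mulnC.
  by apply: leq_trans (leq_divM d.-1 L); rewrite leq_mul2r le orbT.
pose f (j : 'I_(d.-1 %/ L + 1)) : 'I_d := Ordinal (lt j (ltn_ord j)).
have f_inj : injective f.
  move=> i j /(congr1 val) /= /eqP; rewrite eqn_pmul2l // => /eqP; exact: val_inj.
have : (#|codom f| <= #|[set i : 'I_d | (L %| i)%N]|)%N.
  apply/subset_leq_card/fintype.subsetP => i /codomP[j ->].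
  by rewrite inE /= dvdn_mulr.
rewrite card_codom // card_ord -(leq_pmul2l L_gt0); apply: leq_trans.
by have := ltn_ceil d.-1 L_gt0; rewrite -addn1 mulnC; lia.
Qed.

(** If [Q <= |z| ^ L], the coefficients at the multiples of [L] are the digits
    of an expansion in base [z ^ L], hence are determined by the others. *)
Lemma vanishing_card_large (z : algC) (E : nat) : (0 < K)%N -> (0 < E)%N ->
  2 <= `|z| ^+ E -> (#|vanishing z| * 2 ^ (d %/ (2 * E)) <= Q ^ d)%N.
Proof.
move=> K_gt0 E_gt0 big_z; pose t := up_log 2 Q; pose L := (E * t)%N.
have Q_gt2 : (2 < Q)%N by rewrite -muln2; lia.
have le_Q : (Q <= 2 ^ t)%N by apply: up_logP.
have gt_Q : (2 ^ t.-1 < Q)%N by apply: up_log_gtn => //; apply: ltnW.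
(* t >= 2 ensures t <= 2 (t - 1), where 2 ^ (t - 1) < Q *)
have t_gt1 : (1 < t)%N.
  by rewrite -(@ltn_exp2l 2) //; apply: leq_trans le_Q.
have L_gt0 : (0 < L)%N by rewrite muln_gt0 E_gt0 ltnW.
have big_L : Q%:R <= `|z ^+ L|.
  rewrite normrX exprM; apply: le_trans (_ : 2 ^+ t <= _).
    by rewrite -natrX ler_nat.
  by rewrite lerXn2r ?nnegrE ?exprn_ge0.
pose S := [set i : 'I_d | (L %| i)%N].
have le1 : (#|vanishing z| * Q ^ #|S| <= Q ^ d)%N.
  apply: card_le1_fiber => v w vz wz vw; apply: digit_sum_inj (vw) _ => i _.
  set u := \sum_(i < d) _; suff -> : u = 0 by rewrite coef0.
  have uz : root (pC u) z := vanishingB vz wz.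
  pose p := \poly_(j < d) u`_(L * j).
  have up : u = p \Po 'X^L.
    apply/polyP => j; rewrite coef_comp_poly_Xn // coef_poly.
    case: ifP => [/dvdnP[k ->]|nLj].
      rewrite mulnK // mulnC; case: ltnP => // le_dk; rewrite nth_default //.
      apply: leq_trans (_ : d <= _)%N; last first.
        by apply: leq_trans le_dk _; rewrite leq_pmull.
      by rewrite /u size_digit_sum // => l; rewrite leqNgt ltn_ord.
    rewrite coef_digit_sum; case: insubP => // k _ kj.
    by move/agree_offP: vw => ->; rewrite ?subrr // inE kj nLj.
  suff p0 : p = 0 by rewrite up p0 comp_poly0.
  apply: (@cauchy_root_bound p K.*2 (z ^+ L)) => // [j|].
    rewrite coef_poly; case: ifP => _; last by rewrite normr0.
    rewrite coef_digit_sum; case: insubP => [k _ _|_]; last by rewrite normr0.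
    have := ltn_ord (v k); have := ltn_ord (w k).
    by move: (nat_of_ord (v k)) (nat_of_ord (w k)) => a b; lia.
  move: uz; rewrite up map_comp_poly /= map_polyXn /root horner_comp.
  by rewrite hornerXn.
rewrite (leq_trans _ le1) // leq_mul2l; apply/orP; right.
have pow_le : ((2 ^ t.-1) ^ #|S| <= Q ^ #|S|)%N.
  by case: #|S| => // s; rewrite leq_exp2r // ltnW.
apply: leq_trans pow_le.
rewrite -expnM leq_exp2l //.
have := card_multiples L_gt0; rewrite -/S /L => le_d.
rewrite -(leq_pmul2l (_ : 0 < 2 * E)%N) ?muln_gt0 // mulnC.
apply: leq_trans (leq_divM _ _) _; apply: leq_trans le_d _.
have -> : (2 * E * (t.-1 * #|S|) = E * (2 * t.-1) * #|S|)%N by ring.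
by rewrite leq_mul // leq_mul //; lia.
Qed.

(** The coefficients at multiples of [k] enter through their sum only, to which
    anticoncentration applies; those at 1, ..., n - 1 and this sum are then
    determined, as 1, z, ..., z ^ (n - 1) are independent over the integers. *)
Lemma vanishing_card_unity (z : algC) (k n : nat) : (0 < K)%N ->
  (0 < k)%N -> z ^+ k = 1 -> (0 < n)%N -> (n <= k)%N -> (n <= d)%N ->
  (forall u : {poly int}, u != 0 -> root (pC u) z -> (n < size u)%N) ->
  (2 * #|vanishing z| ^ 2 * d * (Q ^ n.-1) ^ 2 <= 3 * k * (Q ^ d) ^ 2)%N.
Proof.
move=> K_gt0 k_gt0 zk n_gt0 le_nk le_nd deg_z.
pose S0 := [set i : 'I_d | (k %| i)%N].
pose S1 := [set i : 'I_d | (0 < i < n)%N].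
have disj : [disjoint S0 & S1].
  rewrite -setI_eq0; apply/eqP/setP => i; rewrite !inE; apply/negP.
  move=> /andP[ki /andP[i_gt0 lt_in]].
  by have := dvdn_leq i_gt0 ki; rewrite leqNgt (leq_trans lt_in).
have cS1 : #|S1| = n.-1.
  have lt (j : 'I_n.-1) : (j.+1 < d)%N by have := ltn_ord j; lia.
  have -> : S1 = [set Ordinal (lt j) | j : 'I_n.-1].
    apply/setP => i; rewrite inE; apply/andP/imsetP => [[i_gt0 lt_in]|[j _ ->]]; last first.
      by rewrite /=; have := ltn_ord j; lia.
    have lt_i : (i.-1 < n.-1)%N by lia.
    by exists (Ordinal lt_i) => //; apply: val_inj; rewrite /= prednK.
  by rewrite card_imset ?card_ord // => i j /(congr1 val)/= [] /val_inj.
have cS : #|S0 :|: S1| = (#|S0| + n.-1)%N.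
  by rewrite cardsU disjoint_setI0 // cards0 subn0 cS1.
pose same v := [set w : {ffun 'I_d -> 'I_Q} | agree_off S0 w v &
                   (\sum_(i in S0) w i == \sum_(i in S0) v i)%N].
pose N := (\max_v #|same v|)%N.
have N_le : (2 * N ^ 2 * #|S0|.+1 <= 3 * (Q ^ #|S0|) ^ 2)%N.
  rewrite /N; apply: (big_ind (fun x => 2 * x ^ 2 * #|S0|.+1 <= _)%N) => [//|x y Hx Hy|v _].
    by rewrite /maxn; case: ifP.
  exact: sum_on_card_le.
have fib v : (#|[set w in vanishing z | agree_off (S0 :|: S1) w v]| <= N)%N.
  set A := [set w in _ | _]; case: (set_0Vmem A) => [->|[v0 v0A]]; first by rewrite cards0.
  apply: leq_trans (leq_bigmax v0); apply/subset_leq_card/fintype.subsetP => w wA.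
  move: v0A wA; rewrite !inE => /andP[vz /agree_offP v0v] /andP[wz /agree_offP wv].
  have wv0 i : i \notin S0 :|: S1 -> w i = v0 i by move=> iS; rewrite wv ?v0v.
  (* reducing the exponents in S0 modulo k turns the difference of the two
     polynomials into one of degree less than n *)
  pose c i : int := if i \in S1 then (w i)%:Z - (v0 i)%:Z else 0.
  pose C : int := \sum_(i in S0) ((w i)%:Z - (v0 i)%:Z).
  pose p := C%:P + \sum_(i < d) (c i)%:P * 'X^i.
  have szp : (size p <= n)%N.
    apply: leq_trans (size_polyD _ _) _; rewrite geq_max (leq_trans (size_polyC_leq1 _)) //=.
    by apply: size_digit_sum => i le_ni; rewrite /c inE [(i < n)%N]ltnNge le_ni andbF.
  have pz : root (pC p) z.
    apply/rootP; have wV : w \in vanishing z by rewrite inE.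
    have vV : v0 \in vanishing z by rewrite inE.
    have /rootP := vanishingB wV vV; rewrite horner_digit_sum => E0.
    have -> : pC p = pC C%:P + pC (\sum_(i < d) (c i)%:P * 'X^i) by rewrite -rmorphD.
    rewrite hornerD horner_digit_sum map_polyC hornerC /=.
    rewrite -[RHS]E0 [RHS](bigID (mem S0)) /=; congr (_ + _).
      rewrite rmorph_sum; apply: eq_bigr => i; rewrite inE => /dvdnP[j ->].
      by rewrite mulnC exprM zk expr1n mulr1.
    rewrite [LHS](bigID (mem S0)) /= [X in X + _]big1 ?add0r => [|i iS0]; last first.
      by rewrite /c (disjointFr disj) // mul0r.
    apply: eq_bigr => i iS0; rewrite /c; case: ifPn => // iS1.
    by rewrite wv0 ?subrr // inE negb_or iS0.
  have p0 : p = 0.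
    by apply/eqP/negPn/negP => nz; have := deg_z p nz pz; rewrite ltnNge szp.
  have c0 i : i \in S1 -> w i = v0 i.
    move=> iS1; have /polyP/(_ i) := p0; rewrite coefD coefC coef_digit_sum valK coef0.
    rewrite /c iS1; move: iS1; rewrite inE lt0n => /andP[/negPf-> _]; rewrite add0r.
    by move=> /eqP; rewrite subr_eq0 => /eqP[] /val_inj.
  have C0 : C = 0.
    have /polyP/(_ 0%N) := p0; rewrite coefD coefC coef_digit_sum coef0 /=.
    by case: insubP => [i _ i0|_]; rewrite ?addr0 // /c inE i0 addr0.
  apply/andP; split.
    apply/agree_offP => i iS0; case: (boolP (i \in S1)) => [/c0//|iS1].
    by rewrite wv0 // inE negb_or iS0.
  move: C0 => /eqP; rewrite /C sumrB subr_eq0.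
  by rewrite -!(big_morph Posz PoszD (erefl _)).
have := card_le_fibers fib; rewrite card_ord cS expnD => le.
have le_d : (d <= k * #|S0|)%N := card_multiples k_gt0.
have Qp : (0 < (Q ^ #|S0|) ^ 2)%N by rewrite !expn_gt0.
rewrite -(leq_pmul2r Qp).
have -> : (2 * #|vanishing z| ^ 2 * d * (Q ^ n.-1) ^ 2 * (Q ^ #|S0|) ^ 2 =
   2 * (#|vanishing z| * (Q ^ #|S0| * Q ^ n.-1)) ^ 2 * d)%N by ring.
apply: leq_trans (_ : 2 * (N * Q ^ d) ^ 2 * (k * #|S0|.+1) <= _)%N.
  rewrite leq_mul // ?leq_mul2l ?leq_exp2r //.
  by apply: leq_trans le_d _; rewrite leq_mul2l leqnSn orbT.
have -> : (2 * (N * Q ^ d) ^ 2 * (k * #|S0|.+1) =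
   2 * N ^ 2 * #|S0|.+1 * (k * (Q ^ d) ^ 2))%N by ring.
have -> : (3 * k * (Q ^ d) ^ 2 * (Q ^ #|S0|) ^ 2 =
   3 * (Q ^ #|S0|) ^ 2 * (k * (Q ^ d) ^ 2))%N by ring.
by rewrite leq_mul2r N_le orbT.
Qed.

End RandomPolynomial.

(** * Densities of the exceptional digit sequences *)

(** For an odd prime power p ^ e this is p <= (p - 1) ^ 2; only the factor 2
    itself loses a constant in [le_2totient_sqr]. *)
Lemma odd_le_totient_sqr k : odd k -> (k <= totient k ^ 2)%N.
Proof.
have [m] := ubnP k; elim: m => // m IH in k *; rewrite ltnS => le_km odd_k.
have [k1|k1] := leqP k 1.
  by case: k k1 odd_k {le_km} => [|[|]].
have k_gt0 : (0 < k)%N by apply: ltnW.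
pose p := pdiv k; have p_pr : prime p by apply: pdiv_prime.
have [p_dv odd_p] : (p %| k)%N /\ odd p by rewrite pdiv_dvd (dvdn_odd (pdiv_dvd k)).
have [j cop_pj Ek] := pfactor_coprime p_pr k_gt0; set e := logn p k in Ek.
have e_gt0 : (0 < e)%N by rewrite logn_gt0 mem_primes p_pr k_gt0.
have odd_j : odd j by apply: dvdn_odd odd_k; rewrite Ek dvdn_mulr.
have p_gt2 : (2 < p)%N by rewrite odd_prime_gt2.
have j_gt0 : (0 < j)%N by case: (j) odd_j.
have lt_jk : (j < m)%N.
  apply: leq_trans le_km; rewrite Ek -[X in (X < _)%N]muln1 ltn_pmul2l //.
  by rewrite -(expn0 p) ltn_exp2l // ltnW.
have pow_le : (p ^ e <= totient (p ^ e) ^ 2)%N.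
  rewrite totient_pfactor // -{1}(prednK e_gt0) expnS expnMn leq_mul //.
    by case: (p) p_gt2 => [|[|[|q]]] // _ /=; nia.
  by rewrite -expnM leq_exp2l ?leq_pmulr // ltnW.
rewrite Ek totient_coprime; last by rewrite coprime_sym coprimeXl.
by rewrite expnMn leq_mul // IH.
Qed.

Lemma le_2totient_sqr k : (0 < k)%N -> (k <= 2 * totient k ^ 2)%N.
Proof.
move=> k_gt0; have two_pr : prime 2 by [].
have [j cop Ek] := pfactor_coprime two_pr k_gt0; set e := logn 2 k in Ek.
have odd_j : odd j by rewrite -coprime2n.
have le_j := odd_le_totient_sqr odd_j.
have [e0|e_gt0] := posnP e.
  by rewrite Ek e0 muln1 (leq_trans le_j) // leq_pmull.
rewrite Ek totient_coprime; last by rewrite coprime_sym coprimeXl.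
rewrite totient_pfactor // mul1n expnMn mulnCA leq_mul //.
by rewrite -expnM -expnS leq_exp2l //; lia.
Qed.

Lemma minpoly_has_root g : int_minpoly g -> exists z, root (pC g) z.
Proof.
move=> [mg sg _]; have : size (zroots g) != 0%N by rewrite size_zroots // -lt0n; lia.
by case E : (zroots g) => [//|z s] _; exists z; rewrite root_zroots // E mem_head.
Qed.

Section Densities.

Variables (R : realType) (d K : nat).
Hypothesis K_gt0 : (0 < K)%N.
Local Notation Q := K.*2.+1.
Local Notation Omega := {ffun 'I_d -> 'I_Q}.

Definition density (B : {set Omega}) : R := #|B|%:R / Q%:R ^+ d.

Let Qd_gt0 : 0 < Q%:R ^+ d :> R. Proof. by rewrite exprn_gt0 ?ltr0n. Qed.

Lemma densityU (A B : {set Omega}) : density (A :|: B) <= density A + density B.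
Proof.
rewrite /density -mulrDl ler_pM2r ?invr_gt0 // -natrD ler_nat cardsU.
exact: leq_subr.
Qed.

Lemma density_le (A B : {set Omega}) : A \subset B -> density A <= density B.
Proof. by move=> /subset_leq_card le; rewrite ler_pM2r ?invr_gt0 // ler_nat. Qed.

Lemma density_bigcup (I : Type) (s : seq I) (P : pred I) (A : I -> {set Omega}) :
  density (\bigcup_(i <- s | P i) A i) <= \sum_(i <- s | P i) density (A i).
Proof.
elim/big_rec2: _ => [|i x B _ le]; first by rewrite /density cards0 mul0r.
by apply: le_trans (densityU _ _) _; rewrite lerD2l.
Qed.

(** The union bound over the objects [g], finitely many of which are selected by
    choosing one for each member of [B]. *)
Lemma density_union (T : eqType) (B : {set Omega}) (P : T -> Prop) (V : T -> {set Omega})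
    (c : nat) (x : R) :
  (forall v, v \in B -> exists2 g, P g & v \in V g) ->
  (forall g, P g -> density (V g) <= x) ->
  (forall s : seq T, uniq s -> (forall g, g \in s -> P g) -> (size s <= c)%N) ->
  0 <= x -> density B <= c%:R * x.
Proof.
move=> cov Vle cnt x0.
have [->|[v0 v0B]] := set_0Vmem B.
  by rewrite /density cards0 mul0r mulr_ge0.
have [g0 _ _] := cov _ v0B.
have [G HG] : exists G : Omega -> T, forall v, v \in B -> P (G v) /\ v \in V (G v).
  apply: (@fin_all_exists _ _ (fun v g => v \in B -> P g /\ v \in V g)) => v.
  by case: (boolP (v \in B)) => [/cov[g Pg vg]|_]; [exists g | exists g0].
pose s := undup [seq G v | v <- enum B].
have sP g : g \in s -> P g.
  by rewrite mem_undup => /mapP[v]; rewrite mem_enum => /HG[Pv _] ->.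
have le_s : (size s <= c)%N by apply: cnt; rewrite ?undup_uniq.
apply: le_trans (_ : density (\bigcup_(g <- s) V g) <= _).
  apply: density_le; apply/fintype.subsetP => v vB; have [_ vV] := HG v vB.
  rewrite (bigD1_seq (G v)) ?undup_uniq //=; first by rewrite inE vV.
  by rewrite mem_undup map_f // mem_enum.
apply: le_trans (density_bigcup _ _ _) _.
apply: le_trans (_ : \sum_(g <- s) x <= _).
  by rewrite big_seq [leRHS]big_seq; apply: ler_sum => g /sP/Vle.
by rewrite big_const_seq count_predT iter_addr_0 -[leLHS]mulr_natl ler_wpM2r // ler_nat.
Qed.


(** The roots of a minimal polynomial being simple, vanishing at all of them is
    divisibility; this form is decidable. *)
Definition divisible (g : {poly int}) : {set Omega} :=
  [set v | all (root (pC (digit_poly v))) (zroots g)].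

Definition has_minpoly_factor (n : nat) (C : {poly int} -> Prop) : {set Omega} :=
  [set v | `[< exists g, [/\ int_minpoly g, size g = n.+1, C g & v \in divisible g] >]].

Lemma divisible_sub g z : int_minpoly g -> root (pC g) z -> divisible g \subset vanishing d K z.
Proof.
move=> [mg _ _]; rewrite root_zroots // => gz.
by apply/fintype.subsetP => v; rewrite !inE => /allP/(_ z gz).
Qed.

Lemma density_factor_le (n q : nat) (C : {poly int} -> Prop) (x : R) :
  (0 < n)%N -> (1 < q)%N -> 0 <= x ->
  (forall g, C g -> mahler g ^+ 4 <= q%:R) ->
  (forall g, int_minpoly g -> size g = n.+1 -> C g -> density (divisible g) <= x) ->
  density (has_minpoly_factor n C) <= (32 * n * q ^ n)%:R * x.
Proof.
move=> n_gt0 q_gt1 x0 Cq Cx.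
apply: (@density_union _ _ (fun g => [/\ int_minpoly g, size g = n.+1 & C g]) divisible) => //.
- by move=> v; rewrite inE => /asboolP[g [Mg sg Cg vg]]; exists g.
- by move=> g [Mg sg Cg]; apply: Cx.
- move=> s us sP; apply: small_mahler_card => // g /sP[Mg sg Cg].
  by split=> //; apply: Cq.
Qed.

Lemma density_divisible_degree g n : int_minpoly g -> size g = n.+1 -> (n <= d)%N ->
  density (divisible g) <= (Q%:R ^+ n)^-1.
Proof.
move=> Mg sg le_nd; have [z gz] := minpoly_has_root Mg.
apply: le_trans (density_le (divisible_sub Mg gz)) _.
rewrite ler_pdivrMr // ler_pdivlMl ?exprn_gt0 ?ltr0n // -!natrX -natrM ler_nat mulnC.
apply: vanishing_card_degree => // u u0 uz.
by rewrite -sg; apply: int_minpoly_size_le Mg gz uz u0.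
Qed.

Lemma density_divisible_mahler g n e : int_minpoly g -> size g = n.+1 -> (0 < n)%N ->
  (0 < e)%N -> 2 < mahler g ^+ e -> density (divisible g) <= (2 ^+ (d %/ (2 * (n * e))))^-1.
Proof.
move=> Mg sg n_gt0 e_gt0 big; have [mg _ _] := Mg.
have [z gz big_z] := large_root_exists mg sg n_gt0 big.
apply: le_trans (density_le (divisible_sub Mg gz)) _.
rewrite ler_pdivrMr // ler_pdivlMl ?exprn_gt0 ?ltr0n // -!natrX -natrM ler_nat mulnC.
by apply: vanishing_card_large; rewrite ?muln_gt0 ?n_gt0.
Qed.

Lemma density_small_mahler n : (0 < n)%N -> (n <= d)%N ->
  density (has_minpoly_factor n (fun g => mahler g ^+ 4 <= 2))
    <= (32 * n * 2 ^ n)%:R / Q%:R ^+ n.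
Proof.
move=> n_gt0 le_nd; have x0 : 0 <= (Q%:R ^+ n)^-1 :> R by rewrite invr_ge0 exprn_ge0.
apply: density_factor_le => // g Mg sg _.
by apply: density_divisible_degree.
Qed.

Lemma density_large_mahler n q : (0 < n)%N -> (1 < q)%N ->
  density (has_minpoly_factor n (fun g => 2 < mahler g ^+ 4 <= q%:R))
    <= (32 * n * q ^ n)%:R / 2 ^+ (d %/ (8 * n)).
Proof.
move=> n_gt0 q_gt1.
have x0 : 0 <= (2 ^+ (d %/ (8 * n)))^-1 :> R by rewrite invr_ge0 exprn_ge0.
apply: density_factor_le => // [g /andP[]//|g Mg sg /andP[big _]].
have := density_divisible_mahler Mg sg n_gt0 (isT : (0 < 4)%N) big.
by rewrite (_ : 2 * (n * 4) = 8 * n)%N //; lia.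
Qed.

Lemma density_nonunity n : (0 < n)%N ->
  density (has_minpoly_factor n (fun g => mahler g ^+ 4 <= 2 /\ 2 < mahler g ^+ (2 ^ n.+3)))
    <= (32 * n * 2 ^ n)%:R / 2 ^+ (d %/ (n * 2 ^ n.+4)).
Proof.
move=> n_gt0.
have x0 : 0 <= (2 ^+ (d %/ (n * 2 ^ n.+4)))^-1 :> R by rewrite invr_ge0 exprn_ge0.
apply: density_factor_le => // [g []//|g Mg sg [_ big]].
have := density_divisible_mahler Mg sg n_gt0 (expn_gt0 2 n.+3) big.
by rewrite (_ : 2 * (n * 2 ^ n.+3) = n * 2 ^ n.+4)%N // mulnCA -expnS.
Qed.

(** The union is over the order k of the root of unity, which determines g. Its
    degree n is the totient of k, so that k <= 2 n ^ 2. *)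
Lemma density_unity n : (0 < n)%N -> (n <= d)%N ->
  density (has_minpoly_factor n
      (fun g => exists z k, [/\ root (pC g) z, (0 < k)%N & z ^+ k = 1]))
    <= (2 * n ^ 2)%:R * (2 * n%:R / (Num.sqrt d%:R * Q%:R ^+ n.-1)).
Proof.
move=> n_gt0 le_nd; have d_gt0 : (0 < d)%N by apply: leq_trans le_nd.
set C := fun g => _.
have QC := map_ratr_intr.
have x0 : 0 <= 2 * n%:R / (Num.sqrt d%:R * Q%:R ^+ n.-1) :> R.
  by rewrite divr_ge0 ?mulr_ge0 ?sqrtr_ge0 ?exprn_ge0.
pose P k := (0 < k <= 2 * n ^ 2)%N /\
  exists g z, [/\ int_minpoly g, size g = n.+1, root (pC g) z & k.-primitive_root z].
pose V (k : nat) := [set v : Omega | `[< exists2 z, k.-primitive_root z & v \in vanishing d K z >]].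
apply: (@density_union _ _ P V) => //.
- move=> v; rewrite inE => /asboolP[g [Mg sg [z [k [gz k_gt0 zk]]] vg]].
  have [l prim_z _] := prim_order_exists k_gt0 zk.
  have l_gt0 := prim_order_gt0 prim_z.
  exists l; last first.
    rewrite inE; apply/asboolP; exists z => //.
    by apply: (fintype.subsetP (divisible_sub Mg gz)).
  split; last by exists g, z.
  rewrite l_gt0; apply: leq_trans (le_2totient_sqr l_gt0) _.
  rewrite leq_mul2l /= leq_exp2r //.
  have [p [Dp mp dvp]] := minCpolyP z.
  have sp : size p = (totient l).+1.
    rewrite -(size_map_poly (ratr : rat -> algC)) -Dp (minCpoly_cyclotomic prim_z).
    by rewrite -Cintr_Cyclotomic // size_pC size_Cyclotomic.
  move: gz; rewrite -QC dvp => /dvdp_leq.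
  rewrite -(map_poly_eq0 (ratr : rat -> algC)) QC -size_poly_eq0 size_pC sg => /(_ isT).
  by rewrite -(size_map_poly (ratr : rat -> algC) (map_poly _ _)) QC size_pC sg sp.
- move=> k [/andP[k_gt0 le_k] [g [z [Mg sg gz prim_z]]]].
  have zk := prim_expr_order prim_z.
  have deg_z (u : {poly int}) : u != 0 -> root (pC u) z -> (n < size u)%N.
    by move=> u0 uz; rewrite -sg; apply: int_minpoly_size_le Mg gz uz u0.
  have sub : V k \subset vanishing d K z.
    apply/fintype.subsetP => v; rewrite inE => /asboolP[y prim_y]; rewrite !inE.
    rewrite -!QC; have [p [Dp mp dvp]] := minCpolyP y.
    rewrite dvp => /dvdpP[r ->]; rewrite rmorphM /= rootM -Dp.
    by rewrite (minCpoly_cyclotomic prim_y) (root_cyclotomic prim_y) prim_z orbT.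
  apply: le_trans (density_le sub) _.
  have le_nk : (n <= k)%N.
    have := deg_z ('X^k - 1); rewrite size_XnsubC // ltnS; apply.
      by rewrite -size_poly_eq0 size_XnsubC.
    by rewrite rmorphB /= map_polyXn rmorph1 /root !hornerE zk subrr.
  have := vanishing_card_unity K_gt0 k_gt0 zk n_gt0 le_nk le_nd deg_z.
  rewrite -(ler_nat R) !natrM !natrX -!expr2 => le_V.
  have s_gt0 : 0 < Num.sqrt d%:R * Q%:R ^+ n.-1 :> R.
    by rewrite mulr_gt0 ?sqrtr_gt0 ?exprn_gt0 ?ltr0n.
  rewrite ler_pdivrMr // mulrAC ler_pdivlMr //.
  rewrite -(@ler_pXn2r _ 2) ?nnegrE ?mulr_ge0 ?sqrtr_ge0 ?exprn_ge0 //.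
  rewrite !exprMn sqr_sqrtr //.
  have k_le : k%:R <= 2 * n%:R ^+ 2 :> R by rewrite -natrX -natrM ler_nat.
  have y0 : 0 <= (Q%:R ^+ d) ^+ 2 :> R by rewrite exprn_ge0 // ltW.
  have hb : 0 <= n%:R ^+ 2 * (Q%:R ^+ d) ^+ 2 :> R by rewrite mulr_ge0 ?exprn_ge0.
  have := ler_wpM2r y0 k_le; move: le_V hb.
  move: (#|_|%:R ^+ 2) (_ ^+ d ^+ 2) (_ ^+ n.-1 ^+ 2) d%:R k%:R (n%:R ^+ 2) => a b c e f h.
  by nra.
- move=> s us sP; rewrite -(size_iota 1 (2 * n ^ 2)).
  apply: uniq_leq_size => // k /sP[/andP[k1 k2] _].
  by rewrite mem_iota k1 add1n ltnS.
Qed.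

End Densities.

(** * Sequences whose polynomial has a factor of low degree *)

Section BadSet.

Variables (R : realType) (d K : nat).
Hypotheses (K_gt0 : (0 < K)%N) (d_gt0 : (0 < d)%N).
Local Notation Q := K.*2.+1.
Local Notation Omega := {ffun 'I_d -> 'I_Q}.
Local Notation q := (4 * d ^ 2 * K ^ 4)%N.

Definition low_factor_digits (m : nat) : {set Omega} :=
  [set v | `[< (digit_poly v)`_0 != 0 /\
     exists g h, [/\ digit_poly v = h * g, (1 < size g)%N & (size g <= m.+1)%N] >]].

Lemma digit_coef_sqr_le (v : Omega) (i : 'I_d) : digit_coef v i ^+ 2 <= (K ^ 2)%:Z.
Proof.
rewrite /digit_coef; have := ltn_ord (v i); move: (nat_of_ord (v i)) => a lt_a.
have -> : (K ^ 2)%:Z = K%:Z ^+ 2 by rewrite -!natz natrX.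
rewrite -[_ ^+ 2]real_normK ?num_real // lerXn2r ?nnegrE //.
by lia.
Qed.

Lemma sumsq_digit_poly (v : Omega) :
  \sum_(i < size (digit_poly v)) (digit_poly v)`_i ^+ 2 <= (2 * d * K ^ 2)%:Z.
Proof.
rewrite size_digit_poly big_ord_recr /=.
have -> : (digit_poly v)`_d = 1.
  by have /monicP := digit_poly_monic v; rewrite lead_coefE size_digit_poly.
apply: le_trans (_ : \sum_(i < d) (K ^ 2)%:Z + 1 <= _).
  rewrite expr1n lerD2r; apply: ler_sum => i _.
  by rewrite coef_digit_poly digit_coef_sqr_le.
rewrite sumr_const card_ord -mulr_natr natz -PoszM -[1]/(1%:Z) -PoszD lez_nat.
by have : (0 < d * K ^ 2)%N by [rewrite muln_gt0 d_gt0 expn_gt0 K_gt0]; nia.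
Qed.

(** The minimal polynomial of a root of the factor divides f, its degree is at
    most that of the factor, and Landau's inequality bounds its measure. *)
Lemma low_factor_minpoly (v : Omega) (m : nat) : v \in low_factor_digits m ->
  exists n g, [/\ (0 < n <= m)%N, int_minpoly g, size g = n.+1,
    v \in divisible d K g & mahler g ^+ 4 <= q%:R /\ ~~ root (pC g) 0].
Proof.
rewrite inE => /asboolP[f0 [h [k [Df h_gt1 h_le]]]].
have mf := digit_poly_monic v.
have [z hz] : exists z, root (pC h) z.
  by apply/closed_rootP; rewrite size_pC; move: h_gt1; case: (size h) => [|[]].
have fz : root (pC (digit_poly v)) z by rewrite Df rmorphM /= rootM hz orbT.
have [g Mg gz] := int_minpoly_exists mf fz.
have [mg sg dvg] := Mg; have [l Dg] := dvg _ _ gz fz.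
have h0 : h != 0 by rewrite -size_poly_gt0 ltnW.
have le_gh := int_minpoly_size_le Mg gz hz h0.
exists (size g).-1, g; split=> //.
- by have := leq_trans le_gh h_le; move: sg; case: (size g) => [|[]].
- by rewrite prednK // ltnW.
- rewrite inE; apply/allP => y; rewrite -root_zroots // => gy.
  by rewrite Dg rmorphM /= rootM gy orbT.
split.
  have := mahler_factor_le mf mg Dg.
  have := sumsq_digit_poly v; rewrite -(ler_int algC) => le1 le2.
  rewrite (exprM _ 2 2); have -> : q%:R = (2 * d * K ^ 2)%:Z%:~R ^+ 2 :> algC.
    by rewrite -[(_ * _)%:Z%:~R]/((2 * d * K ^ 2)%:R) -natrX; congr _%:R; ring.
  rewrite lerXn2r ?nnegrE ?exprn_ge0 ?(le_trans le2) //.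
  by apply: le_trans (mahler_ge1 g); rewrite ler01.
apply: contra f0 => g0; have : root (pC (digit_poly v)) 0.
  by rewrite Dg rmorphM /= rootM g0 orbT.
by rewrite /root horner_coef0 coef_map intr_eq0.
Qed.

Lemma real_mahler_exp g e : mahler g ^+ e \is Num.real.
Proof. by rewrite realE exprn_ge0 // (le_trans ler01) // mahler_ge1. Qed.

Let q_gt1 : (1 < q)%N.
Proof. by have := expn_gt0 d 2; have := expn_gt0 K 4; rewrite d_gt0 K_gt0 /=; nia. Qed.

Lemma density_low_factor_le (m : nat) : (m <= d)%N ->
  density R (low_factor_digits m) <=
    \sum_(1 <= n < m.+1) (32 * n * 2 ^ n)%:R / Q%:R ^+ n +
    \sum_(1 <= n < m.+1) (32 * n * q ^ n)%:R / 2 ^+ (d %/ (8 * n)).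
Proof.
move=> le_md.
pose A n : {set Omega} := has_minpoly_factor d K n (fun g => mahler g ^+ 4 <= 2) :|:
   has_minpoly_factor d K n (fun g => 2 < mahler g ^+ 4 <= q%:R).
apply: le_trans (_ : density R (\bigcup_(1 <= n < m.+1) A n) <= _).
  apply: density_le; apply/fintype.subsetP => v /low_factor_minpoly[n [g]].
  move=> [/andP[n_gt0 le_nm] Mg sg vg [gq _]].
  have nI : n \in index_iota 1 m.+1 by rewrite mem_index_iota n_gt0 ltnS.
  rewrite (bigD1_seq n) ?iota_uniq //= inE; apply/orP; left; rewrite inE.
  have [small|big] := real_leP (real_mahler_exp g 4) (realn _ 2).
    by apply/orP; left; rewrite inE; apply/asboolP; exists g.
  by apply/orP; right; rewrite inE; apply/asboolP; exists g; rewrite big gq.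
apply: le_trans (density_bigcup _ _ _ _) _; rewrite -big_split /=.
rewrite !big_nat; apply: ler_sum => n /andP[n_gt0 le_nm].
apply: le_trans (densityU _ _ _) _; apply: lerD.
  by apply: density_small_mahler => //; apply: leq_trans le_md.
exact: density_large_mahler.
Qed.

(** Below degree [N] the polynomials of small measure are split according to
    [kronecker_effective]. *)
Lemma density_low_factor_refined (m N : nat) : (m <= d)%N ->
  density R (low_factor_digits m) <=
    \sum_(1 <= n < m.+1) (2 * n ^ 2)%:R * (2 * n%:R / (Num.sqrt d%:R * Q%:R ^+ n.-1)) +
    \sum_(1 <= n < m.+1)
      (if (n < N)%N then (32 * n * 2 ^ n)%:R / 2 ^+ (d %/ (n * 2 ^ n.+4))
       else (32 * n * 2 ^ n)%:R / Q%:R ^+ n) +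
    \sum_(1 <= n < m.+1) (32 * n * q ^ n)%:R / 2 ^+ (d %/ (8 * n)).
Proof.
move=> le_md.
pose U n : {set Omega} := has_minpoly_factor d K n
   (fun g => exists z k, [/\ root (pC g) z, (0 < k)%N & z ^+ k = 1]).
pose M n : {set Omega} := if (n < N)%N then has_minpoly_factor d K n
     (fun g => mahler g ^+ 4 <= 2 /\ 2 < mahler g ^+ (2 ^ n.+3))
   else has_minpoly_factor d K n (fun g => mahler g ^+ 4 <= 2).
pose L n : {set Omega} := has_minpoly_factor d K n (fun g => 2 < mahler g ^+ 4 <= q%:R).
apply: le_trans (_ : density R (\bigcup_(1 <= n < m.+1) (U n :|: M n :|: L n)) <= _).
  apply: density_le; apply/fintype.subsetP => v /low_factor_minpoly[n [g]].
  move=> [/andP[n_gt0 le_nm] Mg sg vg [gq g0]].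
  have nI : n \in index_iota 1 m.+1 by rewrite mem_index_iota n_gt0 ltnS.
  rewrite (bigD1_seq n) ?iota_uniq //= inE; apply/orP; left; rewrite 2!inE.
  have [small|big] := real_leP (real_mahler_exp g 4) (realn _ 2); last first.
    by apply/orP; right; rewrite inE; apply/asboolP; exists g; rewrite big gq.
  apply/orP; left; rewrite /M; case: (ltnP n N) => _; last first.
    by apply/orP; right; rewrite inE; apply/asboolP; exists g.
  have [tiny|big] := real_leP (real_mahler_exp g (2 ^ n.+3)) (realn _ 2); last first.
    by apply/orP; right; rewrite inE; apply/asboolP; exists g.
  apply/orP; left; rewrite inE; apply/asboolP; exists g; split=> //.
  have [z gz] := minpoly_has_root Mg; have [mg _ _] := Mg.
  have z0 : z != 0 by apply: contraNneq g0 => <-.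
  by have [k k_gt0 zk] := kronecker_effective mg sg tiny gz z0; exists z, k.
apply: le_trans (density_bigcup _ _ _ _) _; rewrite -!big_split /=.
rewrite !big_nat; apply: ler_sum => n /andP[n_gt0 le_nm].
have le_nd : (n <= d)%N by apply: leq_trans le_md.
apply: le_trans (densityU _ _ _) _; apply: lerD; last exact: density_large_mahler.
apply: le_trans (densityU _ _ _) _; apply: lerD; first exact: density_unity.
rewrite /M; case: ifP => _; first exact: density_nonunity.
exact: density_small_mahler.
Qed.

End BadSet.

(** * Numerical estimates *)

(** Compare [n ^ k] with [2 ^ n] through the quotient of [n] by [k + 1]. *)
Lemma poly_le_exp2 (a k : nat) : exists N, forall n, (N <= n)%N -> (a * n ^ k <= 2 ^ n)%N.
Proof.
pose s := k.+1; exists (s * (a * s ^ k))%N => n le_n.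
have le1 : (a * s ^ k <= n %/ s)%N by rewrite leq_divRL // mulnC.
have le2 : (n <= s * 2 ^ (n %/ s))%N.
  have := ltn_ceil n (ltn0Sn k : (0 < s)%N); rewrite mulnC => /ltnW lt.
  by apply: leq_trans lt _; rewrite leq_mul2l ltn_expl // orbT.
apply: leq_trans (_ : a * s ^ k * 2 ^ (k * (n %/ s)) <= _)%N.
  rewrite -mulnA leq_mul2l; apply/orP; right.
  rewrite [(k * _)%N]mulnC expnM -expnMn; have [->|k_gt0] := posnP k; first by rewrite !expn0.
  by rewrite leq_exp2r.
apply: leq_trans (_ : 2 ^ (n %/ s) * 2 ^ (k * (n %/ s)) <= _)%N.
  by rewrite leq_mul2r (leq_trans le1) ?orbT // ltnW // ltn_expl.
rewrite -expnD leq_exp2l // -mulSn -/s mulnC; exact: leq_divM.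
Qed.

Lemma cube_le_exp2 n : (n ^ 3 <= 4 * 2 ^ n)%N.
Proof.
elim: n => // n IH; have [le_n4|lt_4n] := leqP n 4.
  by case: n le_n4 {IH} => [|[|[|[|[|]]]]].
rewrite [(2 ^ _.+1)%N]expnS mulnCA; apply: leq_trans (leq_mul (leqnn 2) IH).
by rewrite !expnS expn0; nia.
Qed.

Section Estimates.

Variable R : realType.

Lemma sum_linear_geometric m :
  \sum_(1 <= n < m.+1) n%:R * (2 / 3) ^+ n.-1 <= 9 :> R.
Proof.
have -> : \sum_(1 <= n < m.+1) n%:R * (2 / 3) ^+ n.-1 =
    9 - (3 * m%:R + 9) * (2 / 3) ^+ m :> R.
  elim: m => [|m IH]; first by rewrite big_geq // expr0; ring.
  by rewrite big_nat_recr //= IH exprS -natr1; move: (_ ^+ m) => x; field.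
rewrite gerBl; apply: mulr_ge0; last by apply: exprn_ge0; lra.
by have := ler0n R m; lra.
Qed.

Lemma sum_geometric_le (x : R) m : 0 <= x -> x < 1 ->
  \sum_(1 <= n < m.+1) x ^+ n.-1 <= (1 - x)^-1.
Proof.
move=> x0 x1; rewrite big_add1 /= big_mkord -[leRHS]mul1r ler_pdivlMr ?subr_gt0 //.
rewrite mulrC -opprB mulNr -subrX1 opprB gerBl exprn_ge0 //.
Qed.

Section Params.

Variables (d K : nat).
Hypothesis K_gt0 : (0 < K)%N.
Local Notation Q := K.*2.+1.

Let Q_ge3 : 3 <= Q%:R :> R.
Proof. by rewrite ler_nat -muln2; lia. Qed.

Let Q_gt0 : 0 < Q%:R :> R. Proof. by rewrite ltr0n. Qed.

Let twoQ_le : 2 / Q%:R <= 2 / 3 :> R.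
Proof. by rewrite ler_wpM2l // lef_pV2 ?posrE. Qed.

Let twoQ_ge0 : 0 <= 2 / Q%:R :> R. Proof. by rewrite divr_ge0. Qed.

Lemma sum_small_mahler_le m :
  \sum_(1 <= n < m.+1) (32 * n * 2 ^ n)%:R / Q%:R ^+ n <= 288 / K%:R :> R.
Proof.
apply: le_trans (_ : 32 / K%:R * \sum_(1 <= n < m.+1) n%:R * (2 / 3) ^+ n.-1 <= _).
  rewrite mulr_sumr !big_nat; apply: ler_sum => n /andP[n_gt0 _].
  rewrite !natrM natrX -mulrA -expr_div_n -{2}(prednK n_gt0) exprS.
  have le1 : 2 / Q%:R <= K%:R^-1 :> R.
    by rewrite ler_pdivrMr // ler_pdivlMl ?ltr0n // -natrM ler_nat -muln2; lia.
  have le2 : (2 / Q%:R) ^+ n.-1 <= (2 / 3) ^+ n.-1 :> R.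
    by rewrite lerXn2r ?nnegrE // divr_ge0.
  have -> : 32 / K%:R * (n%:R * (2 / 3) ^+ n.-1) = 32 * n%:R * (K%:R^-1 * (2 / 3) ^+ n.-1) :> R.
    by ring.
  by rewrite ler_wpM2l ?mulr_ge0 // ler_pM ?exprn_ge0.
have -> : 288 / K%:R = 32 / K%:R * 9 :> R by ring.
by rewrite ler_wpM2l ?sum_linear_geometric // divr_ge0.
Qed.

Hypothesis d_gt0 : (0 < d)%N.

Lemma sum_unity_le m :
  \sum_(1 <= n < m.+1) (2 * n ^ 2)%:R * (2 * n%:R / (Num.sqrt d%:R * Q%:R ^+ n.-1))
    <= 96 / Num.sqrt d%:R :> R.
Proof.
have s_gt0 : 0 < Num.sqrt d%:R :> R by rewrite sqrtr_gt0 ltr0n.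
apply: le_trans (_ : 32 / Num.sqrt d%:R * \sum_(1 <= n < m.+1) (2 / 3) ^+ n.-1 <= _).
  rewrite mulr_sumr !big_nat; apply: ler_sum => n /andP[n_gt0 _].
  have le3 : n%:R ^+ 3 <= 8 * 2 ^+ n.-1 :> R.
    rewrite -!natrX -natrM ler_nat; apply: leq_trans (cube_le_exp2 n) _.
    by rewrite -{1}(prednK n_gt0) expnS mulnA.
  have leQ : (Q%:R ^+ n.-1)^-1 <= (3 ^+ n.-1)^-1 :> R.
    by rewrite lef_pV2 ?posrE ?exprn_gt0 // lerXn2r ?nnegrE // ltW.
  have -> : (2 * n ^ 2)%:R * (2 * n%:R / (Num.sqrt d%:R * Q%:R ^+ n.-1)) =
      4 / Num.sqrt d%:R * (n%:R ^+ 3 * (Q%:R ^+ n.-1)^-1) :> R.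
    by rewrite natrM natrX invfM; ring.
  have -> : 32 / Num.sqrt d%:R * (2 / 3) ^+ n.-1 =
     4 / Num.sqrt d%:R * (8 * 2 ^+ n.-1 * (3 ^+ n.-1)^-1) :> R.
    by rewrite expr_div_n; ring.
  rewrite ler_wpM2l ?divr_ge0 ?sqrtr_ge0 // ler_pM ?exprn_ge0 ?invr_ge0 ?exprn_ge0 //.
have -> : 96 / Num.sqrt d%:R = 32 / Num.sqrt d%:R * 3 :> R by ring.
rewrite ler_wpM2l ?divr_ge0 ?sqrtr_ge0 //.
apply: le_trans (sum_geometric_le m _ _) _; rewrite ?divr_ge0 //; first by lra.
by rewrite le_eqVlt; apply/orP; left; apply/eqP; field.
Qed.


(** With m <= d ^ (1 / 2) / t ^ 2, up to a constant, the logarithm of the left-hand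
    side is of order m t, hence at most d ^ (1 / 2) / t, while the exponent on
    the right is of order d / m, hence at least d ^ (1 / 2) t ^ 2. *)
Lemma class_term_bound (m n t : nat) : (12 <= t)%N -> (K * d < 2 ^ t.+1)%N ->
  (m ^ 2 * t ^ 4 <= 16 * d)%N -> (0 < n <= m)%N ->
  (32 * n * (4 * d ^ 2 * K ^ 4) ^ n * (K * d * m) <= 2 ^ (d %/ (8 * n)))%N.
Proof.
move=> t_ge lt_Kd le_m /andP[n_gt0 le_nm]; set l := t.+1 in lt_Kd.
have m_gt0 : (0 < m)%N by apply: leq_trans le_nm.
have q_le : (4 * d ^ 2 * K ^ 4 <= 2 ^ (2 + 4 * l))%N.
  rewrite expnD -mulnA leq_mul // (mulnC 4 l) expnM.
  apply: leq_trans (_ : (K * d) ^ 4 <= _)%N; last by rewrite leq_exp2r // ltnW.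
  by rewrite expnMn mulnC leq_mul2l leq_pexp2l ?orbT.
have le_ml : (m <= 2 ^ l)%N.
  apply: leq_trans (ltnW lt_Kd); apply: leq_trans (leq_pmull d K_gt0).
  by have : (2 ^ 4 <= t ^ 4)%N; [rewrite leq_exp2r //; lia | nia].
have q_gt0 : (0 < 4 * d ^ 2 * K ^ 4)%N by rewrite muln_gt0 muln_gt0 !expn_gt0 d_gt0 K_gt0.
(* from 56 (1 + l) m ^ 2 <= d, which needs t >= 12 *)
have le_exp : (5 + 3 * l + (2 + 4 * l) * m <= d %/ (8 * m))%N.
  rewrite leq_divRL ?muln_gt0 //.
  apply: leq_trans (_ : 56 * (1 + l) * m ^ 2 <= _)%N.
    have -> : (m ^ 2 = m * m)%N by [].
    by rewrite !mulnA; nia.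
  rewrite -(leq_pmul2l (isT : 0 < 16)%N); apply: leq_trans le_m.
  rewrite [leqRHS]mulnC !mulnA leq_mul2r; apply/orP; right.
  have : (12 ^ 3 <= t ^ 3)%N by rewrite leq_exp2r.
  by rewrite /l (expnS t 3); move: (t ^ 3)%N => c; nia.
apply: leq_trans (_ : 2 ^ (d %/ (8 * m)) <= _)%N; last first.
  by rewrite leq_exp2l // leq_div2l ?muln_gt0 // leq_mul2l le_nm orbT.
apply: leq_trans (_ : 2 ^ (5 + 3 * l + (2 + 4 * l) * m) <= _)%N; last by rewrite leq_exp2l.
have -> : (5 + 3 * l + (2 + 4 * l) * m = 5 + l + (2 + 4 * l) * m + (l + l))%N by ring.
have a : (32 * n <= 2 ^ (5 + l))%N.
  by rewrite expnD leq_mul // (leq_trans le_nm).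
have b : ((4 * d ^ 2 * K ^ 4) ^ n <= 2 ^ ((2 + 4 * l) * m))%N.
  rewrite expnM; apply: leq_trans (leq_pexp2l q_gt0 le_nm) _.
  by rewrite leq_exp2r.
have c : (K * d * m <= 2 ^ (l + l))%N by rewrite expnD leq_mul // ltnW.
by rewrite expnD (expnD _ (5 + l)); apply: leq_mul c; apply: leq_mul.
Qed.


Lemma ln2_ge : 1 / 2 <= ln 2 :> R.
Proof.
rewrite -ler_expR lnK ?posrE //.
have := expR_ge1Dx (- (1 / 2) : R); rewrite expRN => le.
have e_gt0 := expR_gt0 (1 / 2 : R).
have : 1 / 2 <= (expR (1 / 2 : R))^-1 by lra.
by rewrite -[1 / 2]invrK lef_pV2 ?posrE ?invr_gt0 ?divr_gt0 // invrK; lra.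
Qed.

(** The definition of m1 with the natural logarithm replaced by the integer part
    of the binary one, which is at most twice as large. *)
Lemma degree_bound_nat (m : nat) : (2 <= d)%N ->
  m%:R <= Num.sqrt d%:R / ln (K%:R * d%:R) ^+ 2 :> R ->
  (m ^ 2 * trunc_log 2 (K * d) ^ 4 <= 16 * d)%N.
Proof.
move=> d_ge2; have Kd_gt0 : (0 < K * d)%N by rewrite muln_gt0 K_gt0.
set t := trunc_log 2 (K * d).
have [|t_gt0] := posnP t; first by move=> ->; rewrite muln0.
have le_t : t%:R / 2 <= ln (K%:R * d%:R) :> R.
  apply: le_trans (_ : ln (2 ^+ t) <= _).
    rewrite lnXn // -[leRHS]mulr_natl ler_wpM2l //; have := ln2_ge; lra.
  rewrite ler_ln ?posrE ?exprn_gt0 ?mulr_gt0 ?ltr0n // -natrX -natrM ler_nat.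
  exact: trunc_logP.
have t2_gt0 : 0 < t%:R / 2 :> R by rewrite divr_gt0 ?ltr0n.
have y_gt0 : 0 < ln (K%:R * d%:R) :> R by apply: lt_le_trans le_t.
rewrite ler_pdivlMr ?exprn_gt0 // => le_m.
have le1 : m%:R * (t%:R / 2) ^+ 2 <= Num.sqrt d%:R :> R.
  by apply: le_trans le_m; rewrite ler_wpM2l // lerXn2r ?nnegrE // ltW.
have : (m%:R * (t%:R / 2) ^+ 2) ^+ 2 <= d%:R :> R.
  rewrite -[leRHS]sqr_sqrtr //; rewrite lerXn2r ?nnegrE ?sqrtr_ge0 //.
rewrite -(ler_nat R) natrM natrX natrX (natrM _ 16) => le2.
have -> : m%:R ^+ 2 * t%:R ^+ 4 = 16 * (m%:R * (t%:R / 2) ^+ 2) ^+ 2 :> R by field.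
by rewrite ler_wpM2l.
Qed.

Lemma sum_large_mahler_le (m : nat) : (2 ^ 12 <= d)%N ->
  m%:R <= Num.sqrt d%:R / ln (K%:R * d%:R) ^+ 2 :> R ->
  (m <= d)%N /\
  \sum_(1 <= n < m.+1) (32 * n * (4 * d ^ 2 * K ^ 4) ^ n)%:R / 2 ^+ (d %/ (8 * n))
    <= (K%:R * d%:R)^-1 :> R.
Proof.
move=> d_ge le_m; set t := trunc_log 2 (K * d).
have Kd_gt0 : (0 < K * d)%N by rewrite muln_gt0 K_gt0.
have t_ge : (12 <= t)%N.
  by apply: trunc_log_max => //; apply: leq_trans d_ge (leq_pmull _ _).
have lt_Kd : (K * d < 2 ^ t.+1)%N by apply: trunc_log_ltn.
have d_ge2 : (2 <= d)%N by apply: leq_trans d_ge.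
have le_mt := degree_bound_nat d_ge2 le_m; rewrite -/t in le_mt.
have le_md : (m <= d)%N.
  have : (2 ^ 4 <= t ^ 4)%N by rewrite leq_exp2r // (leq_trans _ t_ge).
  by move: le_mt; rewrite -!mulnn; nia.
split=> //; have [->|m_gt0] := posnP m; first by rewrite big_geq // invr_ge0 mulr_ge0.
apply: le_trans (_ : \sum_(1 <= n < m.+1) ((K * d * m)%:R)^-1 <= _).
  rewrite !big_nat; apply: ler_sum => n; rewrite ltnS => n_le.
  rewrite ler_pdivrMr ?exprn_gt0 // ler_pdivlMl ?ltr0n ?muln_gt0 ?K_gt0 ?d_gt0 //.
  by rewrite -natrX -natrM ler_nat mulnC; apply: class_term_bound t_ge lt_Kd le_mt n_le.
rewrite sumr_const_nat subn1 /= -[leLHS]mulr_natl natrM natrM invfM mulrCA mulfV ?mulr1 //.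
by rewrite pnatr_eq0 -lt0n.
Qed.

End Params.

(** For n below N, where 2 ^ N <= d ^ 0.9, the exponent on the right exceeds
    d ^ 0.1 up to logarithms, whereas the left-hand side is at most a power of d. *)
Lemma nonunity_term_bound : exists D, forall d n, (D <= d)%N ->
  (0 < n < trunc_log (2 ^ 10) (d ^ 9))%N ->
  (32 * n * 2 ^ n * d ^ 2 <= 2 ^ (d %/ (n * 2 ^ n.+4)))%N.
Proof.
have poly c : exists N, forall l, (N <= l)%N -> (2 * (c * l ^ 2) ^ 10 <= 2 ^ l)%N.
  have [N HN] := poly_le_exp2 (2 * c ^ 10) 20; exists N => l /HN.
  by rewrite -mulnA expnMn -expnM.
have [N0 HN0] := poly 144%N; exists (2 ^ N0)%N => d n le_d /andP[n_gt0].
set N := trunc_log _ _ => lt_nN.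
have d_gt0 : (0 < d)%N by apply: leq_trans le_d; rewrite expn_gt0.
pose l := (trunc_log 2 d).+1.
have l_gt0 : (0 < l)%N by [].
have lt_dl : (d < 2 ^ l)%N by apply: trunc_log_ltn.
have le_ld : (2 ^ l <= 2 * d)%N by rewrite expnS leq_mul2l /= trunc_logP.
have le_N : ((2 ^ 10) ^ N <= d ^ 9)%N by apply: trunc_logP; rewrite // expn_gt0 d_gt0.
have le_N0 : (N0 <= l)%N.
  by rewrite ltnW // -(@ltn_exp2l 2) // (leq_ltn_trans le_d).
have le_2N : (2 ^ N <= d)%N.
  rewrite -(@leq_exp2r _ _ 10) // -expnM mulnC expnM (leq_trans le_N) //.
  by rewrite leq_pexp2l.
have le_Nl : (N <= l)%N.
  by rewrite ltnW // -(@ltn_exp2l 2) // (leq_ltn_trans le_2N).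
have key : ((5 + 4 * l) * (n * 2 ^ n.+4) <= d)%N.
  have -> : (n * 2 ^ n.+4 = n * 16 * 2 ^ n)%N by rewrite !expnS; ring.
  apply: leq_trans (_ : 144 * l ^ 2 * 2 ^ N <= _)%N.
    rewrite mulnA leq_mul //; last by rewrite leq_exp2l // ltnW.
    have le_nl : (n <= l)%N by rewrite (leq_trans (ltnW lt_nN)).
    by rewrite -mulnn; nia.
  rewrite -(@leq_exp2r _ _ 10) // expnMn -expnM mulnC [(N * 10)%N]mulnC expnM.
  rewrite [X in (_ <= X)%N]expnSr leq_mul //.
  by rewrite -(leq_pmul2l (isT : 0 < 2)%N) (leq_trans (HN0 l le_N0)).
apply: leq_trans (_ : 2 ^ (5 + 4 * l) <= _)%N; last first.
  by rewrite leq_exp2l // leq_divRL // muln_gt0 n_gt0 expn_gt0.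
have -> : (5 + 4 * l = 5 + l + l + l * 2)%N by ring.
rewrite !expnD (expnM _ l); apply: leq_mul; last by rewrite leq_exp2r // ltnW.
have le_2n : (2 ^ n <= 2 ^ l)%N.
  by rewrite leq_exp2l // (leq_trans (ltnW lt_nN)).
by rewrite leq_mul // leq_mul // (leq_trans _ le_2n) // ltnW // ltn_expl.
Qed.

(** (17 / 25) ^ 9 < 2 ^ (- 5), hence (17 / 25) ^ (18 N) <= 2 ^ (- 10 N), which is
    about d ^ (- 9) for the chosen N; then take the root of order 18. *)
Lemma tail_ratio_bound d : (0 < d)%N ->
  (17 / 25) ^+ trunc_log (2 ^ 10) (d ^ 9) <= 2 / Num.sqrt d%:R :> R.
Proof.
move=> d_gt0; set N := trunc_log _ _; set x : R := 17 / 25.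
have x0 : 0 <= x by rewrite divr_ge0.
have lt_d : (d ^ 9 < (2 ^ 10) ^ N.+1)%N by apply: trunc_log_ltn.
have s_gt0 : 0 < Num.sqrt d%:R :> R by rewrite sqrtr_gt0 ltr0n.
have x9 : x ^+ 9 <= (2 ^+ 5)^-1.
  by rewrite /x; lra.
rewrite ler_pdivlMr // -(@ler_pXn2r _ 18) ?nnegrE ?mulr_ge0 ?exprn_ge0 ?sqrtr_ge0 //.
rewrite exprMn [Num.sqrt _ ^+ 18](exprM _ 2 9) sqr_sqrtr // -exprM.
rewrite (_ : N * 18 = 9 * (N * 2))%N; last by ring.
rewrite exprM.
have le1 : (x ^+ 9) ^+ (N * 2) <= (2 ^+ (10 * N))^-1.
  apply: le_trans (_ : ((2 ^+ 5)^-1) ^+ (N * 2) <= _).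
    by rewrite lerXn2r ?nnegrE ?exprn_ge0 // invr_ge0 exprn_ge0.
  by rewrite exprVn -exprM (_ : 5 * (N * 2) = 10 * N)%N //; ring.
apply: le_trans (_ : (2 ^+ (10 * N))^-1 * 2 ^+ (10 * N.+1) <= _).
  rewrite ler_pM ?exprn_ge0 // -!natrX ler_nat expnM; exact: ltnW.
have n0 : 2 ^+ (10 * N) != 0 :> R by rewrite expf_neq0 // pnatr_eq0.
rewrite mulnS [(10 + _)%N]addnC exprD mulKf //.
by apply: ler_weXn2l; rewrite ?ler1n.
Qed.

(** Bernoulli's inequality. The ratio is chosen so that its product with 2 / 3,
    which is 17 / 25, still satisfies [tail_ratio_bound]. *)
Lemma linear_le_geometric n : n%:R <= 50 * (51 / 50) ^+ n :> R.
Proof.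
suff : 1 + n%:R / 50 <= (51 / 50) ^+ n :> R by lra.
elim: n => [|n IH]; first by rewrite mul0r addr0 expr0.
rewrite exprS -natr1; have := ler0n R n; move: IH.
by move: (_ ^+ n) (n%:R) => x y; lra.
Qed.

Lemma sum_threshold_le (e c x : R) (N m : nat) : 0 <= e -> 0 <= c -> 0 <= x -> x < 1 ->
  \sum_(1 <= n < m.+1) (if (n < N)%N then e else c * (1 - x) * x ^+ n)
    <= m%:R * e + c * x ^+ N.
Proof.
move=> e0 c0 x0 x1.
suff : \sum_(1 <= n < m.+1) (if (n < N)%N then e else c * (1 - x) * x ^+ n)
    <= m%:R * e + c * (x ^+ N - x ^+ maxn N m.+1).
  by move=> /le_trans; apply; rewrite lerD2l ler_wpM2l // gerBl exprn_ge0.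
elim: m => [|m IH].
  rewrite big_geq // mul0r add0r mulr_ge0 // subr_ge0.
  by apply: ler_wiXn2l; rewrite ?(ltW x1) // leq_maxl.
rewrite big_nat_recr //=; case: ltnP => [lt_mN|le_Nm].
  have -> : maxn N m.+2 = N by apply/maxn_idPl.
  have := IH; rewrite (_ : maxn N m.+1 = N); last by apply/maxn_idPl/ltnW.
  by rewrite subrr mulr0 !addr0 -natr1 mulrDl mul1r lerD2r.
have := IH; rewrite (_ : maxn N m.+1 = m.+1); last by apply/maxn_idPr.
rewrite (_ : maxn N m.+2 = m.+2); last by apply/maxn_idPr; apply: leqW.
rewrite [x ^+ m.+2]exprS -natr1; move: (\sum_(_ <= _ < _) _) (x ^+ m.+1) (x ^+ N) => S y z.
by lra.
Qed.

(** Below the threshold each of the at most d terms is at most d ^ (- 2); above it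
    the sum is a geometric tail. *)
Lemma sum_refined_le : exists D, forall d K m, (D <= d)%N -> (0 < d)%N -> (0 < K)%N ->
  (m <= d)%N ->
  \sum_(1 <= n < m.+1)
      (if (n < trunc_log (2 ^ 10) (d ^ 9))%N
       then (32 * n * 2 ^ n)%:R / 2 ^+ (d %/ (n * 2 ^ n.+4))
       else (32 * n * 2 ^ n)%:R / (K.*2.+1)%:R ^+ n) <= 10001 / Num.sqrt d%:R :> R.
Proof.
have [D HD] := nonunity_term_bound; exists D => d K m le_Dd d_gt0 K_gt0 le_md.
set N := trunc_log _ _.
have s_ge1 : 1 <= Num.sqrt d%:R :> R.
  by rewrite -[leLHS]sqrtr1 ler_wsqrtr // ler1n.
have s_gt0 : 0 < Num.sqrt d%:R :> R by apply: lt_le_trans s_ge1.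
have s2 : Num.sqrt d%:R ^+ 2 = d%:R :> R by rewrite sqr_sqrtr.
pose x : R := 17 / 25; pose e : R := (d%:R ^+ 2)^-1.
(* 5000 = 32 * 50 / (1 - 17 / 25) *)
have [c c0 cE] : exists2 c : R, 0 <= c & c = 5000 by exists 5000; rewrite ?ler0n.
have x0 : 0 <= x by rewrite divr_ge0.
have x1 : x < 1 by rewrite /x; lra.
have e0 : 0 <= e by rewrite invr_ge0 exprn_ge0.
apply: le_trans (_ : \sum_(1 <= n < m.+1)
    (if (n < N)%N then e else c * (1 - x) * x ^+ n) <= _).
  rewrite !big_nat; apply: ler_sum => n /andP[n_gt0 le_nm].
  case: ifP => lt_nN.
    rewrite ler_pdivrMr ?exprn_gt0 // ler_pdivlMl ?exprn_gt0 ?ltr0n //.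
    rewrite -!natrX -natrM ler_nat mulnC; apply: HD => //.
    by rewrite n_gt0.
  have -> : c * (1 - x) * x ^+ n = 1600 * x ^+ n by rewrite cE /x; field.
  have xE : x ^+ n = (51 / 50) ^+ n * (2 / 3) ^+ n.
    by rewrite -exprMn; congr (_ ^+ n); rewrite /x; field.
  have le1 : (2 / (K.*2.+1)%:R) ^+ n <= (2 / 3) ^+ n :> R.
    rewrite lerXn2r ?nnegrE ?divr_ge0 // ler_wpM2l // lef_pV2 ?posrE ?ltr0n //.
    by rewrite ler_nat -muln2; lia.
  rewrite natrM natrM natrX -mulrA -expr_div_n xE.
  apply: le_trans (_ : 32 * n%:R * (2 / 3) ^+ n <= _).
    by rewrite ler_wpM2l // mulr_ge0.
  rewrite mulrA ler_wpM2r ?exprn_ge0 ?divr_ge0 //.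
  by have := linear_le_geometric n; lra.
apply: le_trans (sum_threshold_le N m e0 c0 x0 x1) _.
have le_x : x ^+ N <= 2 / Num.sqrt d%:R := tail_ratio_bound d_gt0.
have le_me : m%:R * e <= (Num.sqrt d%:R)^-1.
  apply: le_trans (_ : d%:R^-1 <= _).
    rewrite /e ler_pdivrMr ?exprn_gt0 ?ltr0n // expr2 mulKf ?ler_nat //.
    by rewrite pnatr_eq0 -lt0n.
  by rewrite lef_pV2 ?posrE ?ltr0n // -[leRHS]s2 expr2 ler_peMr // ltW.
have -> : 10001 / Num.sqrt d%:R = (Num.sqrt d%:R)^-1 + c * (2 / Num.sqrt d%:R) :> R.
  by rewrite cE; move: (lt0r_neq0 s_gt0) => n0; field.
by apply: lerD => //; apply: ler_wpM2l.
Qed.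

End Estimates.

(** * From digit sequences to random polynomials *)

Local Open Scope classical_set_scope.
Local Open Scope ring_scope.

Lemma size_le_fset_set (A : set int) (s : seq int) : finite_set A -> uniq s ->
  (forall k, k \in s -> A k) -> (size s <= #|` fset_set A|)%N.
Proof.
move=> fA us sA; apply: uniq_leq_size => // k /sA Ak.
suff : k \in fset_set A by [].
by rewrite in_fset_set //; apply/mem_set.
Qed.

Lemma finite_coef_values K i : finite_set (coef_values K i).
Proof.
pose s := [seq (t : nat)%:Z - K%:Z | t <- iota 0 K.*2.+1].
apply: (@sub_finite_set _ _ [set` s]) => // k [le_k _].
suff : k \in s by []; apply/mapP; exists `|(k + K%:Z)%R|%N; last by lia.
by rewrite mem_iota /= -muln2; lia.
Qed.

Lemma card_coef_values_ge K i :
  ((if i == 0 then K.*2 else K.*2.+1) <= #|` fset_set (coef_values K i)|)%N.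
Proof.
pose s := [seq (t : nat)%:Z - K%:Z | t <- iota 0 K.*2.+1].
have us : uniq s by rewrite map_inj_uniq ?iota_uniq // => a b; lia.
have sz : size s = K.*2.+1 by rewrite size_map size_iota.
have sK k : k \in s -> `|k| <= K%:Z.
  by move=> /mapP[t]; rewrite mem_iota /= -muln2 => lt_t ->; lia.
case: eqVneq => [->|i0].
  apply: leq_trans (size_le_fset_set (finite_coef_values K 0) (rem_uniq 0 us) _).
    rewrite size_rem ?sz //.
    by apply/mapP; exists K; rewrite ?subrr // mem_iota /= -muln2; lia.
  by move=> k; rewrite mem_rem_uniq // inE => /andP[k0 /sK le_k]; split.
rewrite -sz; apply: size_le_fset_set => //; first exact: finite_coef_values.
by move=> k /sK le_k; split=> // i0'; rewrite i0' in i0.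
Qed.

Section RandomPolynomialEvent.

Context (disp : measure_display) (T : measurableType disp) (R : realType).
Variables (P : probability T R) (d K : nat) (f : T -> {poly int}).
Hypotheses (d_gt0 : (0 < d)%N) (K_gt0 : (0 < K)%N).
Hypothesis f_random : random_polyP P d K f.
Local Notation Q := K.*2.+1.
Local Notation Omega := {ffun 'I_d -> 'I_Q}.

Let cylinder (v : Omega) : set T :=
  \bigcap_(i in [set` [set: 'I_d]%SET]) ((fun w => (f w)`_i) @^-1` [set digit_coef v i]).

Lemma measurable_cylinder v : measurable (cylinder v).
Proof.
case: f_random => _ mf _ _; apply: fin_bigcap_measurable => // i _.
exact: mf.
Qed.

(** Independence makes this the product of the probabilities of the coefficients,
    the constant one being uniform on 2 K values only. *)
Lemma probability_cylinder_le v : (digit_poly v)`_0 != 0 ->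
  (P (cylinder v) <= (((K.*2)%:R * Q%:R ^+ d.-1)^-1)%:E)%E.
Proof.
move=> v0; case: f_random => _ _ indep unif.
rewrite /cylinder (indep [set: _]%SET (fun i => [set digit_coef v i])).
pose x (i : 'I_d) : R := (#|` fset_set (coef_values K i)|)%:R^-1.
rewrite (eq_bigr (fun i => (x i)%:E)); last first.
  move=> i _; apply: unif; split.
    rewrite /digit_coef; have := ltn_ord (v i); move: (nat_of_ord (v i)) => a.
    by rewrite -muln2; lia.
  by move=> i0; rewrite -coef_digit_poly i0.
rewrite prodEFin lee_fin.
rewrite (eq_bigl predT) => [|i]; last by rewrite inE.
rewrite (bigD1 (Ordinal d_gt0)) //= invfM; apply: ler_pM.
- by rewrite invr_ge0.
- by apply: prodr_ge0 => i _; rewrite invr_ge0.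
- rewrite lef_pV2 ?posrE ?ltr0n //; first by rewrite ler_nat; apply: (card_coef_values_ge K 0).
    by apply: leq_trans (card_coef_values_ge K 0); rewrite double_gt0.
  by rewrite double_gt0.
have -> : (Q%:R ^+ d.-1)^-1 = \prod_(i < d | i != Ordinal d_gt0) (Q%:R^-1 : R).
  by rewrite prodr_const cardC1 card_ord exprVn.
apply: ler_prod => i i0; rewrite invr_ge0 ler0n /=.
have := card_coef_values_ge K i; rewrite (_ : (i == 0 :> nat) = false) => [le|]; last first.
  by apply: contraNF i0 => /eqP i0; apply/eqP/val_inj.
by rewrite lef_pV2 ?posrE ?ltr0n ?ler_nat // (leq_trans _ le).
Qed.

Lemma digit_poly_of_polyP (p : {poly int}) : Defs.polyP d K p -> exists v : Omega, p = digit_poly v.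
Proof.
move=> [mp sp cp].
exists [ffun i : 'I_d => inord `|(p`_i + K%:Z)%R|%N].
apply/polyP => j; have [lt_jd|] := ltnP j d.
  rewrite (coef_digit_poly _ (Ordinal lt_jd)) /digit_coef ffunE /=.
  have [le_p _] := cp j lt_jd; move: (p`_j) le_p => k le_k.
  have lt_k : (`|(k + K%:Z)%R|%N < Q)%N by rewrite -muln2; lia.
  by rewrite inordK //; lia.
rewrite leq_eqVlt => /predU1P[<-|lt_dj].
  have := digit_poly_monic [ffun i : 'I_d => inord `|(p`_i + K%:Z)%R|%N : 'I_Q].
  move=> /monicP; move/monicP: mp; rewrite !lead_coefE size_digit_poly sp /=.
  by move=> -> ->.
by rewrite !nth_default ?size_digit_poly ?sp.
Qed.

Lemma cylinder_digit_poly v w : cylinder v w -> f w = digit_poly v.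
Proof.
case: f_random => /(_ w) [mp sp cp] _ _ _ vw; apply/polyP => j.
have [lt_jd|] := ltnP j d.
  rewrite (coef_digit_poly _ (Ordinal lt_jd)).
  by have := vw (Ordinal lt_jd); rewrite /= inE; apply.
rewrite leq_eqVlt => /predU1P[<-|lt_dj].
  have /monicP := digit_poly_monic v.
  move/monicP: mp; rewrite !lead_coefE size_digit_poly sp /=.
  by move=> -> ->.
by rewrite !nth_default ?size_digit_poly ?sp.
Qed.

(** The event is a finite disjoint union of cylinders, one for each sequence of
    digits with nonzero constant coefficient, of equal probability
    1 / (2 K Q ^ (d - 1)) = (Q / (2 K)) Q ^ (- d). *)
Lemma probability_low_degree_le (x : R) (m : nat) :
  (forall n, (n%:R <= x) = (n <= m)%N) ->
  (P [set w | has_low_degree_divisor x (f w)]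
    <= (3 / 2 * density R (@low_factor_digits d K m))%:E)%E.
Proof.
move=> xm; pose B := enum (@low_factor_digits d K m).
have low_degreeE (v : Omega) : (digit_poly v)`_0 != 0 ->
    has_low_degree_divisor x (digit_poly v) <-> v \in low_factor_digits d K m.
  move=> v0; rewrite inE; split.
    move=> [g [sg gx [h Dg]]]; apply/asboolP; split=> //; exists g, h.
    by rewrite xm in gx; split=> //; move: sg gx; case: (size g) => [|[]].
  move=> /asboolP[_ [g [h [Dg g1 gm]]]]; exists g; rewrite xm.
  by split; [move: g1 | move: gm | exists h]; case: (size g) => [|[]].
have -> : [set w | has_low_degree_divisor x (f w)] = \big[setU/set0]_(v <- B) cylinder v.
  rewrite -bigcup_seq; apply/seteqP; split=> w /=.
    case: f_random => /(_ w) fP _ _ _ low.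
    have [v Ev] := digit_poly_of_polyP fP.
    have v0 : (digit_poly v)`_0 != 0.
      by rewrite -Ev; have [_ _ /(_ 0%N d_gt0)[_]] := fP; apply.
    exists v; first by rewrite /= mem_enum; apply/(low_degreeE v v0); rewrite -Ev.
    by move=> i _ /=; rewrite Ev coef_digit_poly.
  move=> [v]; rewrite /= mem_enum => vB vw; rewrite (cylinder_digit_poly vw).
  have v0 : (digit_poly v)`_0 != 0 by move: vB; rewrite inE => /asboolP[].
  exact/(low_degreeE v v0).
pose c : R := ((K.*2)%:R * Q%:R ^+ d.-1)^-1.
apply: le_trans (_ : (\sum_(v <- B) P (cylinder v) <= _)%E).
  elim: (B) => [|v s IH]; first by rewrite !big_nil measure0.
  rewrite !big_cons; apply: le_trans (measureU2 _ _ _) _.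
  - exact: measurable_cylinder.
  - by apply: bigsetU_measurable => u _; apply: measurable_cylinder.
  - by rewrite leeD2l.
apply: le_trans (_ : (\sum_(v <- B) c%:E <= _)%E).
  rewrite big_seq [leRHS]big_seq; apply: lee_sum => v.
  by rewrite mem_enum inE => /asboolP[v0 _]; apply: probability_cylinder_le.
rewrite sumEFin lee_fin big_const_seq count_predT iter_addr_0 -cardE -[leLHS]mulr_natl.
rewrite /density [leRHS]mulrCA ler_wpM2l // /c -{2}(prednK d_gt0) exprS.
have Kp : 1 <= K%:R :> R by rewrite ler1n.
have p0 : 0 < Q%:R ^+ d.-1 :> R by rewrite exprn_gt0 ?ltr0n.
have QE : Q%:R = 2 * K%:R + 1 :> R by rewrite -natr1 -muln2 natrM mulrC.
rewrite !invfM mulrA; apply: ler_wpM2r; first by rewrite invr_ge0 ltW.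
rewrite QE -muln2 natrM [K%:R * 2]mulrC; move: K%:R Kp => k k1.
by rewrite ler_pdivlMr ?ler_pdivrMl; lra.
Qed.

End RandomPolynomialEvent.

(** * The theorem *)

Lemma m1_ge0 (R : realType) d K : 0 <= m1 R d K.
Proof. by rewrite /m1 divr_ge0 ?sqrtr_ge0 ?sqr_ge0. Qed.

Lemma low_degree_probability_le_invK (R : realType) : exists D, forall d K, (D <= d)%N ->
  (0 < K)%N -> forall (disp : measure_display) (T : measurableType disp)
    (P : probability T R) (f : T -> {poly int}), random_polyP P d K f ->
  (P [set w | has_low_degree_divisor (m1 R d K) (f w)] <= (434 / K%:R)%:E)%E.
Proof.
exists (2 ^ 12)%N => d K le_d K_gt0 disp T P f f_random.
have d_gt0 : (0 < d)%N by apply: leq_trans le_d; rewrite expn_gt0.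
pose m := Num.truncn (m1 R d K).
have mE n : (n%:R <= m1 R d K) = (n <= m)%N by rewrite truncn_ge_nat ?m1_ge0.
have [le_md large] := @sum_large_mahler_le R d K K_gt0 d_gt0 m le_d
  (eq_ind_r is_true (leqnn m) (mE m)).
apply: le_trans (probability_low_degree_le d_gt0 K_gt0 f_random mE) _.
rewrite lee_fin; have := density_low_factor_le R K_gt0 d_gt0 le_md.
have := sum_small_mahler_le R K_gt0 m.
have : (K%:R * d%:R)^-1 <= K%:R^-1 :> R.
  by rewrite lef_pV2 ?posrE ?mulr_gt0 ?ltr0n // ler_peMr // ler1n.
have : 0 <= K%:R^-1 :> R by rewrite invr_ge0.
move: large; move: (\sum_(_ <= _ < _) _) (\sum_(_ <= _ < _) _) (density _ _) => a b c.
by lra.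
Qed.

Lemma low_degree_probability_le_sqrt (R : realType) :
  exists2 C : R, 0 <= C & exists D, forall d K, (D <= d)%N ->
  (0 < K)%N -> forall (disp : measure_display) (T : measurableType disp)
    (P : probability T R) (f : T -> {poly int}), random_polyP P d K f ->
  (P [set w | has_low_degree_divisor (m1 R d K) (f w)] <= (C / Num.sqrt d%:R)%:E)%E.
Proof.
have [D HD] := sum_refined_le R; exists 15147; first exact: ler0n.
exists (maxn D (2 ^ 12))%N => d K; rewrite geq_max => /andP[le_Dd le_d] K_gt0.
move=> disp T P f f_random.
have d_gt0 : (0 < d)%N by apply: leq_trans le_d; rewrite expn_gt0.
pose m := Num.truncn (m1 R d K).
have mE n : (n%:R <= m1 R d K) = (n <= m)%N by rewrite truncn_ge_nat ?m1_ge0.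
have [le_md large] := @sum_large_mahler_le R d K K_gt0 d_gt0 m le_d
  (eq_ind_r is_true (leqnn m) (mE m)).
apply: le_trans (probability_low_degree_le d_gt0 K_gt0 f_random mE) _.
rewrite lee_fin.
have := density_low_factor_refined R K_gt0 d_gt0 (trunc_log (2 ^ 10) (d ^ 9)) le_md.
have := sum_unity_le R K_gt0 d_gt0 m.
have := HD d K m le_Dd d_gt0 K_gt0 le_md.
have : (K%:R * d%:R)^-1 <= (Num.sqrt d%:R)^-1 :> R.
  have s_ge1 : 1 <= Num.sqrt d%:R :> R.
    by rewrite -[leLHS]sqrtr1 ler_wsqrtr // ler1n.
  have s_gt0 : 0 < Num.sqrt d%:R :> R by apply: lt_le_trans s_ge1.
  rewrite lef_pV2 ?posrE ?mulr_gt0 ?ltr0n //.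
  apply: le_trans (_ : d%:R <= _); last by rewrite ler_peMl // ler1n.
  by rewrite -[leRHS]sqr_sqrtr // expr2 ler_peMr // ltW.
move: large; move: (\sum_(_ <= _ < _) _) (\sum_(_ <= _ < _) _) (\sum_(_ <= _ < _) _)
  (density _ _) => a b c e.
by lra.
Qed.

Theorem theorem2p5 (R : realType) :
  (exists C : R, forall K : nat -> nat,
    (forall d, (2 <= d)%N -> (0 < K d)%N) ->
    (\forall d \near \oo, (K d)%:R <= expR (d%:R `^ 4^-1) / d%:R :> R) ->
    \forall d \near \oo,
      forall (disp : measure_display) (T : measurableType disp)
             (P : probability T R) (f : T -> {poly int}),
        random_polyP P d (K d) f ->
        (P [set w | has_low_degree_divisor (m1 R d (K d)) (f w)]
          <= (C * Num.sqrt ((K d)%:R / d%:R))%:E)%E)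
  /\
  (forall c1 c2 : R, 0 < c1 -> 0 < c2 ->
   exists C : R, forall K : nat -> nat,
    (forall d, (2 <= d)%N -> (0 < K d)%N) ->
    (\forall d \near \oo,
      c2 * d%:R <= (K d)%:R
      /\ (K d)%:R <= expR (d%:R `^ 4^-1 / b_const c1) / d%:R) ->
    \forall d \near \oo,
      forall (disp : measure_display) (T : measurableType disp)
             (P : probability T R) (f : T -> {poly int}),
        random_polyP P d (K d) f ->
        (P [set w | has_low_degree_divisor (m1 R d (K d)) (f w)]
          <= (C * (1 / (K d)%:R))%:E)%E).
Proof.
split.
  have [C C0 [D HD]] := low_degree_probability_le_sqrt R; exists C => K K_gt0 _.
  exists (maxn D 2) => // d /=; rewrite geq_max => /andP[le_Dd d_ge2] disp T P f f_random.
  have Kd_gt0 := K_gt0 d d_ge2.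
  apply: le_trans (HD d (K d) le_Dd Kd_gt0 disp T P f f_random) _.
  rewrite lee_fin ler_wpM2l // -sqrtrV // ler_wsqrtr //.
  by rewrite ler_peMl ?invr_ge0 // ler1n.
move=> c1 c2 _ _; have [D HD] := low_degree_probability_le_invK R; exists 434 => K K_gt0 _.
exists (maxn D 2) => // d /=; rewrite geq_max => /andP[le_Dd d_ge2] disp T P f f_random.
by rewrite mul1r; apply: HD => //; apply: K_gt0.
Qed.
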